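(* Let $S_0$ be a positive semidefinite $d\times d$ complex matrix and let $\mathbf a=(a_i)_{i\in\mathbb I_k}$ with $a_1\ge\cdots\ge a_k>0$. Let $\tilde\lambda=(\tilde\lambda_i)_{i\in\mathbb I_d}=\|S_0\|\,\mathbf 1_d-\lambda(S_0)$ (whose entries are non-negative and in non-decreasing order), and let $\delta=(\delta_i)_{i\in\mathbb I_d}=\|S_0\|\,\mathbf 1_d-\nu^{\rm op}(\tilde\lambda,\mathbf a)\in\mathbb R^d$. Then: 1. For every unitarily invariant norm $|||\cdot|||$ on the $d\times d$ complex matrices, $$\min\{\,|||S_0-S_{\mathcal G}|||:\ \mathcal G\in\mathbb T_{\mathbb C^d}(\mathbf a)\,\}=|||D_\delta|||.$$ 2. If the unitarily invariant norm $|||\cdot|||$ is strictly convex and $\mathcal G\in\mathbb T_{\mathbb C^d}(\mathbf a)$, then $|||S_0-S_{\mathcal G}|||=|||D_\delta|||$ if and only if $\lambda(S_0-S_{\mathcal G})=\delta^\downarrow$. In this case there exists an orthonormal basis $\{v_i\}_{i\in\mathbb I_d}$ of $\mathbb C^d$ such that $$S_0=\sum_{i\in\mathbb I_d}\lambda_i(S_0)\,v_i\otimes v_i\quad\text{and}\quad S_{\mathcal G}=\sum_{i\in\mathbb I_d}(\lambda_i(S_0)-\delta_i)\,v_i\otimes v_i .$$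
   Context: General notation. $\mathbb I_m=\{1,\dots,m\}$; $\mathbf 1_m=(1,\dots,1)\in\mathbb R^m$; $\|\cdot\|$ is the spectral (operator) norm of matrices (Euclidean norm for vectors); $D_\delta$ is the diagonal matrix with main diagonal $\delta$. For selfadjoint $A$, $\lambda(A)=(\lambda_i(A))_{i\in\mathbb I_d}$ is its vector of eigenvalues with multiplicity in non-increasing order; $x^\downarrow$ is the non-increasing rearrangement of $x$; $(x\otimes y)z=\langle z,y\rangle x$. The frame operator of $\mathcal G=\{g_i\}_{i\in\mathbb I_k}$ is $S_{\mathcal G}=\sum_i g_i\otimes g_i$, and $\mathbb T_{\mathbb C^d}(\mathbf a)=\{\{g_i\}_{i\in\mathbb I_k}\in(\mathbb C^d)^k:\|g_i\|^2=a_i,\ i\in\mathbb I_k\}$. A norm $|||\cdot|||$ on $d\times d$ matrices is unitarily invariant if $|||UAV|||=|||A|||$ for all $A$ and all unitary $U,V$. Majorization: for $x\in\mathbb R^m$, $y\in\mathbb R^n$, $x\prec y$ means $\sum_{i\le j}x_i^\downarrow\le\sum_{i\le j}y_i^\downarrow$ for $1\le j\le\min\{m,n\}$ and $\operatorname{tr}x:=\sum_i x_i=\sum_i y_i=:\operatorname{tr}y$. Definition of $\nu(\lambda,\mathbf a)$ for $\lambda=(\lambda_i)_{i\in\mathbb I_m}$ with $0\le\lambda_1\le\cdots\le\lambda_m$ and $\mathbf a=(a_i)_{i\in\mathbb I_k}$ with $a_1\ge\cdots\ge a_k>0$, $k\ge m$: let $t=\sum_{i\in\mathbb I_k}a_i$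 and let $c>\lambda_1$ be the unique number with $\sum_{i\in\mathbb I_m}(c-\lambda_i)^+=t$, where $y^+=\max\{y,0\}$; then $\nu(\lambda,\mathbf a)=\big((c-\lambda_i)^++\lambda_i\big)_{i\in\mathbb I_m}$ (so $\nu_i=\max\{c,\lambda_i\}$). The pair $(\lambda,\mathbf a)$ is called feasible if $\mathbf a\prec\nu(\lambda,\mathbf a)-\lambda$. Definition of $\nu^{\rm op}(\lambda,\mathbf a)$ for $\lambda=(\lambda_i)_{i\in\mathbb I_d}$ with $0\le\lambda_1\le\cdots\le\lambda_d$ and $\mathbf a=(a_i)_{i\in\mathbb I_k}$ with $a_1\ge\cdots\ge a_k>0$. Case $k\ge d$. For $0\le s\le d-1$ let $\lambda^s=(\lambda_{s+1},\dots,\lambda_d)$ and $\mathbf a^s=(a_{s+1},\dots,a_k)$; the index $s$ is feasible if the pair $(\lambda^s,\mathbf a^s)$ is feasible. For $1\le j\le r\le d$ let $P_{j,r}=\frac1{r-j+1}\sum_{i=j}^r(\lambda_i+a_i)$. Let $s^*$ be the minimum of the feasible indexes $0\le s\le d-1$ (the index $d-1$ is always feasible). If $s^*=0$, set $\nu^{\rm op}(\lambda,\mathbf a)=\nu(\lambda,\mathbf a)$ (this corresponds to $q=1$). Otherwise define recursively, with $s_0^*=0$, as long as $s_j^*<s^*$: $$s_{j+1}^*=\max\Big\{s_j^*<r\le s^*:\ P_{s_j^*+1,r}=\max_{s_j^*<i\le s^*}P_{s_j^*+1,i}\Big\},\qquad c_{j+1}^*=P_{s_j^*+1,s_{j+1}^*},$$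 and let $q$ be such that $s_{q-1}^*=s^*$. Then $$\nu^{\rm op}(\lambda,\mathbf a)=\big(c_1^*\mathbf 1_{s_1^*},\,c_2^*\mathbf 1_{s_2^*-s_1^*},\dots,c_{q-1}^*\mathbf 1_{s_{q-1}^*-s_{q-2}^*},\,\nu(\lambda^{s^*},\mathbf a^{s^*})\big)\in\mathbb R^d .$$ Case $k<d$. Set $\nu^{\rm op}(\lambda,\mathbf a)=\big(\nu^{\rm op}((\lambda_i)_{i\in\mathbb I_k},\mathbf a),\lambda_{k+1},\dots,\lambda_d\big)$, where the first block is constructed by the rule just given for the case $k\ge d$, with $d$ replaced by $k$. *)

(* Defs.v *)
From mathcomp Require Import all_boot all_order all_algebra.
From mathcomp Require Import complex.
From mathcomp Require Import boolp classical_sets reals.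

Set Implicit Arguments.
Unset Strict Implicit.
Unset Printing Implicit Defensive.

Import Order.TTheory GRing.Theory Num.Theory.
Local Open Scope sesquilinear_scope.
Local Open Scope classical_set_scope.
Local Open Scope ring_scope.
Local Open Scope complex_scope.

Section Sequences.
Variable R : realType.
Implicit Types x y lam a : seq R.

Definition decr x : seq R := sort >=%R x.

Definition majorized x y : bool :=
  [forall j : 'I_(minn (size x) (size y)),
     \sum_(z <- take j.+1 (decr x)) z <= \sum_(z <- take j.+1 (decr y)) z]
  && (\sum_(z <- x) z == \sum_(z <- y) z).

(* For lam nonempty and nondecreasing and a positive and nonempty there is
   exactly one such c, so the default value 0 is never used. *)
Definition water_level lam a : R :=
  xget 0 [set c | lam`_0 < c /\
    \sum_(l <- lam) Num.max (c - l) 0 = \sum_(z <- a) z].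

Definition nu lam a : seq R :=
  [seq Num.max (water_level lam a - l) 0 + l | l <- lam].

Definition feasible lam a : bool :=
  majorized a [seq p.1 - p.2 | p <- zip (nu lam a) lam].

(* The least s in {0, ..., size lam - 1} with (lam^s, a^s) feasible. *)
Definition sstar lam a : nat :=
  find (fun s => feasible (drop s lam) (drop s a)) (iota 0 (size lam)).

(* Sequences are indexed from 0, so this is P_{s+1,r} for 1-based indices. *)
Definition Pavg lam a (s r : nat) : R :=
  (\sum_(s <= i < r) (lam`_i + a`_i)) / (r - s)%:R.

(* The passage from s_j^* to s_{j+1}^*. *)
Definition snext lam a (s : nat) : nat :=
  \max_(r < (sstar lam a).+1 | (s < r)%N &&
     [forall i : 'I_(sstar lam a).+1,
        (s < i)%N ==> (Pavg lam a s i <= Pavg lam a s r)]) r.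

(* The constant blocks from position s on. Each step increases s, so fuel
   n = sstar lam a suffices when starting from s = 0. *)
Fixpoint blocks lam a (n s : nat) : seq R :=
  if n is n'.+1 then
    if (s < sstar lam a)%N then
      nseq (snext lam a s - s) (Pavg lam a s (snext lam a s))
        ++ blocks lam a n' (snext lam a s)
    else [::]
  else [::].

(* The case size lam <= size a; for sstar = 0 this is nu lam a. *)
Definition nuop_ge lam a : seq R :=
  blocks lam a (sstar lam a) 0
    ++ nu (drop (sstar lam a) lam) (drop (sstar lam a) a).

Definition nuop lam a : seq R :=
  if (size lam <= size a)%N then nuop_ge lam a
  else nuop_ge (take (size a) lam) a ++ drop (size a) lam.

End Sequences.

Section Matrices.
Variable R : realType.
Local Notation C := R[i].

Definition modulus (z : C) : R := complex.Re `|z|.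

Definition inner d (x y : 'cV[C]_d) : C :=
  \sum_i x i 0 * Num.conj (y i 0).

Definition vnorm d (x : 'cV[C]_d) : R := Num.sqrt (\sum_i modulus (x i 0) ^+ 2).

Definition opnorm d (A : 'M[C]_d) : R :=
  sup [set vnorm (A *m x) | x in [set x | vnorm x <= 1]].

(* x (x) y, that is, z |-> inner z y *: x. *)
Definition tens d (x y : 'cV[C]_d) : 'M[C]_d := x *m y ^t*.

Definition orthonormal_basis d (v : 'I_d -> 'cV[C]_d) : Prop :=
  (forall i j, inner (v i) (v j) = (i == j)%:R) /\
  (forall x, exists c : 'I_d -> C, x = \sum_i c i *: v i).

Definition psd d (A : 'M[C]_d) : Prop :=
  A \is hermsymmx /\ forall x, 0 <= inner (A *m x) x.

(* The real parts are the roots themselves when A is selfadjoint, the only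
   case in which this is used. *)
Definition eigvals d (A : 'M[C]_d) : seq R :=
  decr [seq complex.Re z | z <- sval (closed_field_poly_normal (char_poly A))].

Definition diagonal_mx d (s : seq R) : 'M[C]_d := diag_mx (\row_(i < d) (s`_i)%:C).

Definition frame_op d k (G : 'I_k -> 'cV[C]_d) : 'M[C]_d :=
  \sum_i tens (G i) (G i).

Definition torus d k (a : k.-tuple R) : set ('I_k -> 'cV[C]_d) :=
  [set G | forall i, vnorm (G i) ^+ 2 = tnth a i].

Definition is_norm d (N : 'M[C]_d -> R) : Prop :=
  [/\ forall A B, N (A + B) <= N A + N B,
      forall c A, N (c *: A) = modulus c * N A
    & forall A, N A = 0 -> A = 0].

Definition unitarily_invariant d (N : 'M[C]_d -> R) : Prop :=
  forall A U V, U \is unitarymx -> V \is unitarymx -> N (U *m A *m V) = N A.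

Definition strictly_convex d (N : 'M[C]_d -> R) : Prop :=
  forall (A B : 'M[C]_d) (t : R), A != B -> N A = 1 -> N B = 1 ->
    0 < t -> t < 1 -> N (t%:C *: A + (1 - t)%:C *: B) < 1.

Definition is_minimum (E : set R) (m : R) : Prop := E m /\ lbound E m.

Definition lambda_tilde d (S0 : 'M[C]_d) : seq R :=
  [seq opnorm S0 - l | l <- eigvals S0].

Definition delta d (S0 : 'M[C]_d) (a : seq R) : seq R :=
  [seq opnorm S0 - n | n <- nuop (lambda_tilde S0) a].

End Matrices.

Arguments torus {R} d {k} a _.
Arguments diagonal_mx {R} d s.

(* Main.v *)
Require Import Defs.
From mathcomp Require Import all_boot all_order all_algebra perm fingroup.
From mathcomp Require Import complex.
From mathcomp Require Import boolp classical_sets reals.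
From mathcomp Require Import ring lra zify.

(** Write M for the norm of S0, S for M - S0, with eigenvalues l_0 <= l_1 <= ...,
    and v for nu^op(l, a).  Since S0 - S_G = M - (S + S_G), everything is a
    statement about the spectrum of S + S_G: v is its smallest possible value
    for majorization.

    The description of v by feasible indices and greedy averages hides a simpler
    one, collected in the record [profile].  With n = min(d, k), the first n
    entries are v_i = max(w_i, l_i) for a non-increasing water level w; the
    partial sums of v dominate those of l + a, with equality at every position
    where w drops; beyond n, v is l; and the total of v - l is that of a.  The
    nontrivial point is that the averages of the blocks stay above the final
    water level c, and this is where minimality of s* enters: if some average of
    l_i + a_i over r <= i < s* were at most c, then the largest such r would
    itself be feasible ([feasible_extends_down], [excess_before_sstar]).

    Lower bound.  For a threshold t let p be the first position with w_p <= t.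
    The sum of the positive parts (v_i - t)^+ is then the sum of l_i + a_i - t
    over i < p plus the sum of (l_i - t)^+ over i >= p, or the sum of all l_i - t
    and all a_i if the level exceeds t at all d positions ([profile_pos_part]).
    Testing S + S_G - t against the projector onto the span of the first p
    vectors of G and of the eigenvectors of S with eigenvalue above t, or against
    the identity, bounds this by the sum of positive parts of the eigenvalues
    of S + S_G ([pos_part_ge_prefix], [pos_part_ge_trace]).  Since the traces
    agree, this is majorization.  A vector majorized by another one is reached
    from it by T-transforms ([majorization_ind]), and each T-transform is a convex
    combination of the diagonal matrix with a permuted copy of itself, so it
    cannot increase a unitarily invariant norm, and decreases a strictly convex
    one unless it merely permutes the entries ([norm_rdiag_majorized]).

    Attainment.  v - l is non-increasing, non-negative and majorizes a.  Starting
    from multiples of eigenvectors of S, each T-transform of the squared norms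
    is realized by rotating two vectors of the frame inside their span, with a
    suitable phase, and this leaves the frame operator unchanged
    ([rotate_vectors], [frame_exists]).

    Rigidity.  Suppose that the spectrum of S + S_G is v up to order, and let m
    be the non-increasing spectrum of S_G.  Comparing traces of squares,
      sum v^2 = tr (S + S_G)^2 >= sum (l + m)^2 >= sum v^2 + sum (l + m - v)^2.
    The first inequality is tr (S S_G) >= sum l m ([trace_mul_ge_rearranged]) and
    the second a variational inequality for v ([profile_variational]).  Hence
    m = v - l and tr (S S_G) = sum l m; in this equality case an eigenbasis of
    S_G - S ordered by decreasing eigenvalue diagonalizes S and S_G
    simultaneously, with the required orders. *)

Set Implicit Arguments.
Unset Strict Implicit.
Unset Printing Implicit Defensive.

Import Order.TTheory GRing.Theory Num.Theory.
Local Open Scope classical_set_scope.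
Local Open Scope ring_scope.
Local Open Scope complex_scope.

(** * Existence of the water level and the sequence nu *)

(** The form in which nu^op is used everywhere below: water poured up to a
    level [w i] that may only go down, and only at positions where the partial
    sums of [l + a] are met exactly. *)
Record profile (R : realType) (d k : nat) (l a w v : nat -> R) : Prop := {
  profile_head : forall i, (i < minn d k)%N -> v i = Num.max (w i) (l i);
  profile_tail : forall i, (minn d k <= i < d)%N -> v i = l i;
  profile_level : forall i, (i.+1 < minn d k)%N -> w i.+1 <= w i;
  profile_prefix : forall p, (p <= minn d k)%N ->
    \sum_(0 <= i < p) (l i + a i) <= \sum_(0 <= i < p) v i;
  profile_drop : forall i, (i.+1 < minn d k)%N -> w i.+1 < w i ->
    \sum_(0 <= j < i.+1) (l j + a j) = \sum_(0 <= j < i.+1) v j;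
  profile_total : \sum_(0 <= i < minn d k) v i =
    \sum_(0 <= i < minn d k) l i + \sum_(0 <= i < k) a i
}.

Section WaterFilling.
Variable R : realType.
Implicit Types (lam a : seq R) (c t : R).

Lemma sum_drop_nth (s : nat) (x : seq R) :
  \sum_(z <- drop s x) z = \sum_(s <= i < size x) x`_i.
Proof.
rewrite (big_nth 0) size_drop.
rewrite -[s in RHS]add0n big_addn; apply: eq_bigr => i _.
by rewrite nth_drop addnC.
Qed.

Lemma water_volume_le c c' (l : seq R) : c <= c' ->
  \sum_(x <- l) Num.max (c - x) 0 <= \sum_(x <- l) Num.max (c' - x) 0.
Proof.
move=> cc'; apply: ler_sum => x _.
by rewrite ge_max !le_max lerB //= lexx orbT.
Qed.

(** The volume below level [c] is a piecewise affine function of [c]; removing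
    the largest entry while it stays dry reduces to the affine case. *)
Lemma water_level_exists lam t : lam != [::] -> sorted <=%R lam -> 0 < t ->
  exists c, lam`_0 < c /\ \sum_(l <- lam) Num.max (c - l) 0 = t.
Proof.
move=> lam0 slam t0.
suff [c ct] : exists c, \sum_(l <- lam) Num.max (c - l) 0 = t.
  exists c; split=> //; rewrite ltNge; apply/negP => cl; move: t0.
  rewrite -ct big_seq big1 ?ltxx // => x /(nthP 0)[i ilt <-].
  apply/max_idPr; rewrite subr_le0 (le_trans cl) //.
  by apply: (sorted_leq_nth le_trans lexx 0 slam); rewrite ?inE //; case: (lam) ilt.
elim/last_ind: lam slam lam0 => // l x IH slx _.
have sl : sorted <=%R l by move: slx; rewrite -cats1 => /cat_sorted2[].
have lex y : y \in l -> y <= x.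
  move: slx; rewrite (sorted_pairwise le_trans) pairwise_rcons => /andP[/allP al _].
  by move=> /al.
set T := \sum_(y <- l) Num.max (x - y) 0.
have [Tt|tT] := leP T t.
  (* The remaining volume spreads over all (size l).+1 columns. *)
  pose e := (t - T) / (size l).+1%:R.
  have e0 : 0 <= e by rewrite divr_ge0 ?subr_ge0.
  exists (x + e); rewrite -cats1 big_cat big_seq1 /= addrAC subrr add0r.
  rewrite (max_idPl e0) big_seq.
  rewrite (eq_bigr (fun y => Num.max (x - y) 0 + e)); last first.
    move=> y /lex yx; rewrite (max_idPl _) ?subr_ge0 1?(max_idPl _) ?subr_ge0 //.
      by rewrite addrAC.
    by rewrite (le_trans yx) // lerDl.
  rewrite -big_seq big_split /= -/T big_const_seq count_predT iter_addr_0.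
  rewrite -mulr_natr -addrA -[X in _ + (_ + X)]mulr1 -mulrDr natr1 divfK ?pnatr_eq0 //.
  by rewrite addrC subrK.
have l0 : l != [::].
  by apply/eqP => le; move: tT; rewrite /T le big_nil ltNge ltW.
have [c ct] := IH sl l0; exists c.
rewrite -cats1 big_cat big_seq1 /= ct (max_idPr _) ?addr0 // subr_le0 leNgt.
apply/negP => xc; move: tT; rewrite ltNge -ct water_volume_le // ltW //.
Qed.

Lemma water_levelP lam a : lam != [::] -> sorted <=%R lam ->
    0 < \sum_(z <- a) z ->
  lam`_0 < water_level lam a /\
  \sum_(l <- lam) Num.max (water_level lam a - l) 0 = \sum_(z <- a) z.
Proof.
move=> l0 sl a0; rewrite /water_level; case: xgetP => [y -> //|].
by have [c Pc] := water_level_exists l0 sl a0 => /(_ c).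
Qed.

Lemma nth_nu lam a i : (i < size lam)%N ->
  (nu lam a)`_i = Num.max (water_level lam a) lam`_i.
Proof.
move=> ilt; rewrite (nth_map 0) //; set c := water_level _ _.
by rewrite addr_maxl subrK add0r.
Qed.

Lemma nu_sub lam a : [seq p.1 - p.2 | p <- zip (nu lam a) lam] =
  [seq Num.max (water_level lam a - l) 0 | l <- lam].
Proof.
rewrite /nu; move: (water_level _ _) => c.
by elim: lam => //= x l ->; rewrite addrK.
Qed.

Lemma decr_id (x : seq R) : sorted >=%R x -> decr x = x.
Proof. by move=> sx; apply: sorted_sort => // y z t /= zy tz; apply: le_trans zy. Qed.

Lemma sum_take_nth (p : nat) (x : seq R) : (p <= size x)%N ->
  \sum_(z <- take p x) z = \sum_(0 <= i < p) x`_i.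
Proof.
move=> px; rewrite (big_nth 0) size_takel //.
by apply: eq_big_nat => i /andP[_ ip]; rewrite nth_take.
Qed.

(** Both sequences are already sorted, so majorization is a comparison of plain
    partial sums; equality of the totals is the definition of the water level. *)
Lemma feasibleP lam a : lam != [::] -> sorted <=%R lam -> sorted >=%R a ->
    0 < \sum_(z <- a) z -> (size lam <= size a)%N ->
  reflect (forall p, (p <= size lam)%N -> \sum_(0 <= i < p) a`_i <=
             \sum_(0 <= i < p) Num.max (water_level lam a - lam`_i) 0)
          (feasible lam a).
Proof.
move=> l0 sl sa a0 sz; have [_ tot] := water_levelP l0 sl a0.
rewrite /feasible /majorized nu_sub big_map tot eqxx andbT.
set c := water_level _ _; set m := [seq _ | _ <- _].
have sm : sorted >=%R m.
  rewrite sorted_map; apply: sub_sorted sl => x y /= xy.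
  by rewrite ge_max !le_max lerB //= lexx orbT.
rewrite (decr_id sa) (decr_id sm) size_map (minn_idPr sz).
have E p : (p <= size lam)%N ->
    \sum_(z <- take p m) z = \sum_(0 <= i < p) Num.max (c - lam`_i) 0.
  move=> pl; rewrite sum_take_nth ?size_map //; apply: eq_big_nat => i /andP[_ ip].
  by rewrite (nth_map 0) // (leq_trans ip).
apply: (iffP forallP) => [H p pl|H j].
  case: p pl => [|p] pl; first by rewrite !big_geq.
  by have := H (Ordinal pl); rewrite /= E // sum_take_nth // (leq_trans pl).
by rewrite E // sum_take_nth ?H // (leq_trans (ltn_ord j)).
Qed.

Lemma water_volume_drop s (lam : seq R) c :
  \sum_(l <- drop s lam) Num.max (c - l) 0 =
  \sum_(s <= i < size lam) Num.max (c - lam`_i) 0.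
Proof.
rewrite (big_nth 0) size_drop -[s in RHS]add0n big_addn.
by apply: eq_bigr => i _; rewrite nth_drop addnC.
Qed.

(** * Feasible indices and the constant blocks *)

(** Feasibility of [s] at level [c] passes down to [r < s] if the mean of
    [l + a] over [r, s) is at most [c] while all means over [i, s) with
    [r < i] are at least [c].  The first condition forces the new level
    [c'] to be at most [c].  A partial sum up to [p] is then bounded from below by
    subtracting from the total water the water above [p], which is largest
    at level [c]. *)
Lemma feasible_extends_down (l a : nat -> R) (d k r s p : nat) c c' :
    (r < s < d)%N -> (d <= k)%N ->
    (forall i j, (i <= j < d)%N -> l i <= l j) ->
    l s < c -> l r < c' ->
    \sum_(s <= i < d) Num.max (c - l i) 0 = \sum_(s <= i < k) a i ->
    \sum_(r <= i < d) Num.max (c' - l i) 0 = \sum_(r <= i < k) a i ->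
    (forall p, (s <= p <= d)%N ->
       \sum_(s <= i < p) a i <= \sum_(s <= i < p) Num.max (c - l i) 0) ->
    (forall i, (r < i < s)%N -> 0 <= \sum_(i <= j < s) (l j + a j - c)) ->
    \sum_(r <= j < s) (l j + a j - c) <= 0 ->
    (r <= p <= d)%N ->
  \sum_(r <= i < p) a i <= \sum_(r <= i < p) Num.max (c' - l i) 0.
Proof.
move=> /andP[rs sd] dk lmon lsc lrc' totc totc' feas suf avg /andP[rp pd].
have split3 (f : nat -> R) x y z : (x <= y)%N -> (y <= z)%N ->
    \sum_(x <= i < z) f i = \sum_(x <= i < y) f i + \sum_(y <= i < z) f i.
  by move=> xy yz; apply: big_cat_nat.
have below i : (i < s)%N -> Num.max (c - l i) 0 = c - l i.
  move=> is_; apply/max_idPl; rewrite subr_ge0 ltW // (le_lt_trans _ lsc) //.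
  by rewrite lmon // sd andbT ltnW.
have sumE x : (x <= s)%N -> \sum_(x <= i < s) Num.max (c - l i) 0 =
    \sum_(x <= i < s) a i - \sum_(x <= j < s) (l j + a j - c).
  move=> xs; rewrite -sumrB; apply: eq_big_nat => i /andP[_ is_].
  by rewrite below //; ring.
have trE := split3 a r s k (ltnW rs) (leq_trans (ltnW sd) dk).
(* At level c the columns from r on already hold at least the water poured at c'. *)
have c'c : c' <= c.
  rewrite leNgt; apply/negP => cc'.
  have : \sum_(r <= i < d) Num.max (c - l i) 0 <
         \sum_(r <= i < d) Num.max (c' - l i) 0.
    have rd : (r < d)%N by apply: ltn_trans sd.
    rewrite !(big_ltn rd).
    rewrite ltr_leD //.
      by rewrite gt_max !lt_max ltrD2r cc' subr_gt0 lrc'.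
    apply: ler_sum => i _.
    by rewrite ge_max !le_max lerD2r (ltW cc') lexx orbT.
  rewrite totc' trE (split3 _ r s d (ltnW rs) (ltnW sd)) totc sumE ?(ltnW rs) //.
  by move: avg; lra.
have mon x y : \sum_(x <= i < y) Num.max (c' - l i) 0 <=
               \sum_(x <= i < y) Num.max (c - l i) 0.
  by apply: ler_sum => i _; rewrite ge_max !le_max lerD2r c'c lexx orbT.
have := split3 (fun i => Num.max (c' - l i) 0) r p d rp pd.
rewrite totc' => totE.
have [sp|ps] := leqP s p.
  have f1 := feas p; rewrite sp pd in f1; have := f1 isT.
  have := split3 (fun i => Num.max (c - l i) 0) s p d sp pd.
  have := split3 a r s p (ltnW rs) sp.
  by move: (mon p d); rewrite totc; move: totE; rewrite trE; lra.
move: rp; rewrite leq_eqVlt => /orP[/eqP rp|rp].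
  by rewrite -rp !big_geq.
have f1 := suf p; rewrite rp ps in f1; have := f1 isT.
have := split3 (fun i => Num.max (c - l i) 0) p s d (ltnW ps) (ltnW sd).
have := split3 a r p s (ltnW rp) (ltnW ps).
by rewrite (sumE _ (ltnW ps)); move: (mon p d) totE; rewrite trE totc; lra.
Qed.

Section Blocks.
Variables lam a : seq R.
Hypothesis lam0 : lam != [::].
Hypothesis slam : sorted <=%R lam.
Hypothesis sa : sorted >=%R a.
Hypothesis apos : forall i, (i < size a)%N -> 0 < a`_i.
Hypothesis size_le : (size lam <= size a)%N.

Let lamS i j : (i <= j < size lam)%N -> lam`_i <= lam`_j.
Proof.
move=> /andP[ij jd]; apply: (sorted_leq_nth le_trans lexx 0 slam) => //.
by rewrite inE (leq_ltn_trans ij).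
Qed.

Let level r := water_level (drop r lam) (drop r a).

Let drop_pos r : (r < size lam)%N -> 0 < \sum_(z <- drop r a) z.
Proof.
move=> rd; rewrite sum_drop_nth (big_ltn (leq_trans rd size_le)).
rewrite ltr_wpDr ?apos ?(leq_trans rd) // big_nat_cond sumr_ge0 // => i.
by rewrite andbT => /andP[_ ia]; rewrite ltW ?apos.
Qed.

Let drop_neq0 r : (r < size lam)%N -> drop r lam != [::].
Proof. by move=> rd; rewrite -size_eq0 size_drop -lt0n subn_gt0. Qed.

Lemma levelP r : (r < size lam)%N ->
  lam`_r < level r /\
  \sum_(r <= i < size lam) Num.max (level r - lam`_i) 0 =
  \sum_(r <= i < size a) a`_i.
Proof.
move=> rd.
have [] := water_levelP (drop_neq0 rd) (drop_sorted r slam) (drop_pos rd).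
by rewrite nth_drop addn0 water_volume_drop sum_drop_nth.
Qed.

Lemma feasible_dropP r : (r < size lam)%N ->
  reflect (forall p, (r <= p <= size lam)%N -> \sum_(r <= i < p) a`_i <=
             \sum_(r <= i < p) Num.max (level r - lam`_i) 0)
    (feasible (drop r lam) (drop r a)).
Proof.
move=> rd.
have shift (f : nat -> R) q p g : (forall i, g i = f (q + i)%N) ->
    \sum_(0 <= i < p - q) g i = \sum_(q <= i < p) f i.
  move=> gf; rewrite -[q in RHS]add0n big_addn.
  by apply: eq_bigr => i _; rewrite gf addnC.
pose pos x := Num.max (level r - x) 0.
apply: (iffP (feasibleP _ _ _ _ _)); rewrite ?drop_sorted ?drop_neq0 //.
- by rewrite drop_pos.
- by rewrite !size_drop leq_sub2r.
- move=> H p /andP[rp pd]; have := H (p - r)%N.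
  rewrite size_drop leq_sub2r // => /(_ isT).
  rewrite (shift (nth 0 a) r p _ (fun i => nth_drop _ _ _ i)).
  rewrite (shift (fun i => pos lam`_i) r p) //.
  by move=> i; rewrite nth_drop.
- move=> H p; rewrite size_drop => pd; have := H (r + p)%N.
  have -> : (r <= r + p <= size lam)%N by lia.
  move=> /(_ isT).
  rewrite -(shift (nth 0 a) r _ _ (fun i => nth_drop _ _ _ i)) addKn.
  rewrite -(shift (fun i => pos lam`_i) r _ (fun i => pos (drop r lam)`_i)) ?addKn //.
  by move=> i; rewrite nth_drop.
Qed.

Lemma last_feasible :
  feasible (drop (size lam).-1 lam) (drop (size lam).-1 a).
Proof.
have d0 : (0 < size lam)%N by rewrite lt0n size_eq0.
have rd : ((size lam).-1 < size lam)%N by rewrite prednK.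
have [_ tot] := levelP rd.
apply/(feasible_dropP rd) => p /andP[rp]; rewrite leq_eqVlt => /orP[/eqP ->|pd].
  rewrite tot (big_cat_nat (leq_pred _) size_le) /= lerDl big_nat_cond.
  by rewrite sumr_ge0 // => i; rewrite andbT => /andP[_ ia]; rewrite ltW ?apos.
have -> : p = (size lam).-1 by apply/eqP; rewrite eqn_leq rp andbT -ltnS prednK.
by rewrite !big_geq.
Qed.

Local Notation s := (sstar lam a).

Lemma sstarP : (s < size lam)%N /\ feasible (drop s lam) (drop s a).
Proof.
have d0 : (0 < size lam)%N by rewrite lt0n size_eq0.
have h : has (fun s => feasible (drop s lam) (drop s a)) (iota 0 (size lam)).
  apply/hasP; exists (size lam).-1; last exact: last_feasible.
  by rewrite mem_iota /= add0n prednK.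
have := nth_find 0%N h; move: h; rewrite has_find size_iota -/(sstar lam a) => h.
by rewrite nth_iota.
Qed.

Lemma sstar_min r : (r < s)%N -> ~~ feasible (drop r lam) (drop r a).
Proof.
move=> rs; have := before_find 0%N rs; rewrite nth_iota; first by move=> ->.
by have [h _] := sstarP; apply: ltn_trans h.
Qed.

(** The largest violating [r] would satisfy the hypotheses of
    [feasible_extends_down], against the minimality of [sstar]. *)
Lemma excess_before_sstar r : (r < s)%N ->
  0 < \sum_(r <= j < s) (lam`_j + a`_j - level s).
Proof.
move: {2}(s - r)%N (leqnn (s - r)) => n; elim: n r => [|n IH] r.
  by rewrite leqn0 subn_eq0 leqNgt => /negP.
move=> srn rs; rewrite ltNge; apply/negP => avg.
have [sd feas] := sstarP.
have rd := ltn_trans rs sd.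
have [lsc totc] := levelP sd.
have [lrc totc'] := levelP rd.
move: (sstar_min rs) => /negP[]; apply/(feasible_dropP rd) => p rpd.
apply: (feasible_extends_down (k := size a) (s := s) (c := level s)) rpd => //.
- by rewrite rs.
- exact: (elimT (feasible_dropP sd)).
- move=> i /andP[ri is_]; apply/ltW/IH => //; lia.
Qed.

Let x i := lam`_i + a`_i.

Lemma sum_sub_Pavg r i m : (r < i)%N ->
  \sum_(r <= j < i) (x j - m) = (Pavg lam a r i - m) * (i - r)%:R.
Proof.
move=> ri; rewrite mulrBl /Pavg divfK ?pnatr_eq0 -?lt0n ?subn_gt0 //.
by rewrite sumrB sumr_const_nat mulr_natr.
Qed.

(** The step is the largest maximizer of the average, so later averages are
    strictly smaller; this strictness makes consecutive blocks decrease. *)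
Lemma snextP r : (r < s)%N -> let v := Pavg lam a r (snext lam a r) in
  [/\ (r < snext lam a r <= s)%N,
      forall i, (r < i <= s)%N -> Pavg lam a r i <= v
    & forall i, (snext lam a r < i <= s)%N -> Pavg lam a r i < v].
Proof.
move=> rs.
pose P := [pred q : 'I_s.+1 | (r < q)%N &&
  [forall i : 'I_s.+1, (r < i)%N ==> (Pavg lam a r i <= Pavg lam a r q)]].
have [i0 Pi0 i0max] := @arg_maxP _ _ _ (Ordinal (ltnSn s))
  (fun i : 'I_s.+1 => r < i)%N (fun i : 'I_s.+1 => Pavg lam a r i) rs.
have PP : P i0.
  by rewrite /= Pi0; apply/forallP => j; apply/implyP => rj; apply: i0max.
have [|m Pm mE] := @eq_bigmax_cond _ P (fun i => i : nat).
  by apply/card_gt0P; exists i0.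
have -> : snext lam a r = m by rewrite -mE.
have /andP[rm /forallP mmax] : P m by [].
have mge i : (r < i <= s)%N -> Pavg lam a r i <= Pavg lam a r m.
  by move=> /andP[ri is_]; apply: (implyP (mmax (Ordinal (is_ : (i < s.+1)%N)))).
split=> // [|i /andP[mi is_]]; first by rewrite rm -ltnS ltn_ord.
have ri := ltn_trans rm mi.
rewrite lt_neqAle mge ?ri // andbT; apply/eqP => E.
have : Ordinal (is_ : (i < s.+1)%N) \in P.
  by rewrite inE /= ri; apply/forallP => j; rewrite E.
by move=> /(@leq_bigmax_cond _ _ (fun i : 'I_s.+1 => i : nat)); rewrite mE /= leqNgt mi.
Qed.

Let block_value n r i := (blocks lam a n r)`_(i - r).

Let block_valueS n r i : (r < s)%N -> (r <= i)%N ->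
  block_value n.+1 r i = if (i < snext lam a r)%N then Pavg lam a r (snext lam a r)
                else block_value n (snext lam a r) i.
Proof.
move=> rs ri; have [/andP[rt _] _ _] := snextP rs.
rewrite /block_value /= rs nth_cat size_nseq ltn_sub2rE // nth_nseq ltn_sub2rE //.
by case: ltnP => // ti; congr (_ `_ _); lia.
Qed.

Lemma size_blocks n r : (r <= s)%N -> (s - r <= n)%N ->
  size (blocks lam a n r) = (s - r)%N.
Proof.
elim: n r => [|n IH] r rs srn /=; first by lia.
case: ltnP => [{}rs|sr] /=; last by lia.
have [/andP[rt ts] _ _] := snextP rs.
by rewrite size_cat size_nseq IH //; lia.
Qed.

(** Along a block the prefix averages stay below the block value by maximality,
    and at its end they agree.  The next block is lower, since otherwise the
    union of the two blocks would have had at least the same average; the last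
    one is above the final water level by [excess_before_sstar]. *)
Lemma blocksP n r : (r <= s)%N -> (s - r <= n)%N ->
  [/\ (r < s)%N -> block_value n r r = Pavg lam a r (snext lam a r),
      forall i, (r <= i < s)%N -> level s < block_value n r i,
      forall p, (r <= p <= s)%N ->
        \sum_(r <= i < p) x i <= \sum_(r <= i < p) block_value n r i,
      \sum_(r <= i < s) x i = \sum_(r <= i < s) block_value n r i
    & forall i, (r <= i)%N -> (i.+1 < s)%N ->
       block_value n r i.+1 <= block_value n r i /\
       (block_value n r i.+1 < block_value n r i ->
        \sum_(r <= j < i.+1) x j = \sum_(r <= j < i.+1) block_value n r j)].
Proof.
elim: n r => [|n IH] r; rewrite leq_eqVlt => /orP[/eqP rs|rs] srn; try by lia.
- rewrite {}rs; split; rewrite ?ltnn ?big_geq //.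
  + by move=> i; lia.
  + by move=> p /andP[sp ps]; rewrite !big_geq.
  + by move=> i ri is_; lia.
- rewrite {}rs; split; rewrite ?ltnn ?big_geq //.
  + by move=> i; lia.
  + by move=> p /andP[sp ps]; rewrite !big_geq.
  + by move=> i ri is_; lia.
have [/andP[rt ts] vmax vlt] := snextP rs.
have [|hd0 gt0 pre0 tot0 mon0] := IH _ ts; first by lia.
set t := snext lam a r in rt ts vmax vlt hd0 gt0 pre0 tot0 mon0 *.
set v := Pavg lam a r t in vmax vlt *.
have blE i : (r <= i)%N -> block_value n.+1 r i = if (i < t)%N then v else block_value n t i.
  exact: block_valueS.
have sumlo p : (p <= t)%N -> \sum_(r <= i < p) block_value n.+1 r i = \sum_(r <= i < p) v.
  by move=> pt; apply: eq_big_nat => i /andP[ri ip]; rewrite blE // (leq_trans ip).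
have sumhi p : (t <= p)%N ->
    \sum_(t <= i < p) block_value n.+1 r i = \sum_(t <= i < p) block_value n t i.
  move=> pt; apply: eq_big_nat => i /andP[ri ip].
  by rewrite blE ?(leq_trans (ltnW rt)) // ltnNge ri.
have xt : \sum_(r <= i < t) x i = \sum_(r <= i < t) v.
  apply/eqP; rewrite -subr_eq0 -sumrB sum_sub_Pavg // subrr mul0r //.
have sgn p : (r < p)%N -> \sum_(r <= j < p) (x j - v) =
    (Pavg lam a r p - v) * (p - r)%:R by exact: sum_sub_Pavg.
(* A next block at least as high would contradict maximality of t. *)
have vnext : (t < s)%N -> block_value n t t < v.
  move=> t_s; rewrite hd0 //; have [/andP[tq qs] _ _] := snextP t_s.
  set q := snext lam a t in tq qs *.
  have rq := ltn_trans rt tq.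
  have : \sum_(t <= j < q) (x j - v) < 0.
    have : \sum_(r <= j < q) (x j - v) < 0.
      by rewrite sgn // pmulr_llt0 ?ltr0n ?subn_gt0 // subr_lt0 vlt // tq.
    rewrite (big_cat_nat (ltnW rt) (ltnW tq)) /= sgn // subrr mul0r add0r //.
  by rewrite sum_sub_Pavg // pmulr_llt0 ?ltr0n ?subn_gt0 // subr_lt0.
have cv : level s < v.
  have := ts; rewrite leq_eqVlt => /orP[/eqP t_s|t_s]; last first.
    by rewrite (lt_trans _ (vnext t_s)) // gt0 // leqnn.
  have := excess_before_sstar rs.
  by rewrite sum_sub_Pavg // pmulr_lgt0 ?ltr0n ?subn_gt0 // subr_gt0 /v t_s.
split.
- by move=> _; rewrite blE // rt.
- move=> i /andP[ri is_]; rewrite blE //; case: ltnP => // ti.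
  by rewrite gt0 // ti.
- move=> p /andP[rp ps]; have [pt|tp] := leqP p t.
    rewrite sumlo // -subr_le0 -sumrB.
    move: rp; rewrite leq_eqVlt => /orP[/eqP ->|rp]; first by rewrite big_geq.
    by rewrite sgn // pmulr_lle0 ?ltr0n ?subn_gt0 // subr_le0 vmax // rp.
  rewrite !(big_cat_nat (ltnW rt) (ltnW tp)) /= sumlo // xt lerD2l sumhi ?(ltnW tp) //.
  by rewrite pre0 // (ltnW tp).
- by rewrite !(big_cat_nat (ltnW rt) ts) /= sumlo // xt sumhi // tot0.
- move=> i ri is_; rewrite (blE i) // (blE i.+1) ?(leqW ri) //.
  have [it|ti|it] := ltngtP i.+1 t.
  + by rewrite ltxx.
  + have t_i : (t <= i)%N by [].
    have [m1 m2] := mon0 i t_i is_; split=> // /m2 E.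
    by rewrite !(big_cat_nat (ltnW rt) (ltnW ti)) /= sumlo // xt sumhi ?(ltnW ti) // E.
  + have t_s : (t < s)%N by rewrite -it.
    by rewrite it; split=> [|_]; [apply/ltW/vnext | rewrite sumlo].
Qed.

Lemma size_nuop_ge : size (nuop_ge lam a) = size lam.
Proof.
have [sd _] := sstarP.
by rewrite size_cat size_blocks ?subn0 // size_map size_drop subnKC // ltnW.
Qed.

(** The level is the block value before [sstar] and the last water level after
    it.  The blocks lie above that last level, hence above every entry of
    [lam] up to [sstar], so the maximum with [lam] changes nothing there. *)
Lemma nuop_ge_profile : exists w,
  profile (size lam) (size a) (nth 0 lam) (nth 0 a) w (nth 0 (nuop_ge lam a)).
Proof.
have [sd feas] := sstarP.
have [lsc totc] := levelP sd.
have [_ gt0 pre0 tot0 mon0] := @blocksP s 0 (leq0n _) (leq_subr 0 _).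
pose w i := if (i < s)%N then block_value s 0 i else level s.
pose v := nth 0 (nuop_ge lam a).
have vlo i : (i < s)%N -> v i = block_value s 0 i.
  by move=> is_; rewrite /v /nuop_ge nth_cat size_blocks ?subn0 // is_ /block_value subn0.
have vhi i : (s <= i < size lam)%N -> v i = Num.max (level s) lam`_i.
  move=> /andP[si id_]; rewrite /v /nuop_ge nth_cat size_blocks ?subn0 // ltnNge si /=.
  by rewrite nth_nu ?size_drop ?ltn_sub2rE // nth_drop subnKC.
have sumlo p : (p <= s)%N -> \sum_(0 <= i < p) v i = \sum_(0 <= i < p) block_value s 0 i.
  by move=> ps; apply: eq_big_nat => i /andP[_ ip]; rewrite vlo // (leq_trans ip).
have sumhi p : (s <= p <= size lam)%N -> \sum_(s <= i < p) v i =
    \sum_(s <= i < p) lam`_i + \sum_(s <= i < p) Num.max (level s - lam`_i) 0.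
  move=> /andP[sp pd]; rewrite -big_split; apply: eq_big_nat => i /andP[si ip].
  rewrite vhi ?si ?(leq_trans ip) //=.
  by rewrite addr_maxr addr0 addrC subrK.
exists w; rewrite -/v; split; rewrite (minn_idPl size_le).
- move=> i id_; rewrite /w; case: ltnP => is_; last by rewrite vhi // is_.
  rewrite vlo //; symmetry; apply/max_idPl.
  rewrite (le_trans (lamS _ : _ <= lam`_s)) ?(ltnW is_) //.
  by rewrite ltW // (lt_trans lsc) // gt0.
- by move=> i; lia.
- move=> i id_; rewrite /w; case: (ltnP i.+1 s) => is1.
    by rewrite (ltnW is1); have [] := mon0 i (leq0n _) is1.
  by case: ltnP => // is_; rewrite ltW // gt0.
- move=> p pd; have [ps|sp] := leqP p s; first by rewrite sumlo // pre0.
  rewrite !(big_cat_nat (leq0n s) (ltnW sp)) /= tot0 sumlo // lerD2l.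
  rewrite sumhi ?(ltnW sp) // big_split /= lerD2l.
  by apply: (elimT (feasible_dropP sd) feas); rewrite (ltnW sp).
- move=> i id_; rewrite /w; case: (ltnP i.+1 s) => is1.
    rewrite (ltnW is1) => wlt; have [_ h] := mon0 i (leq0n _) is1.
    by rewrite sumlo ?(ltnW is1) // h.
  case: ltnP => is_; last by rewrite ltxx.
  have iE : i.+1 = s by lia.
  by move=> _; rewrite iE sumlo // -tot0.
- rewrite (big_cat_nat (leq0n s) (ltnW sd)) /= sumlo // -tot0 sumhi ?leqnn ?(ltnW sd) //.
  rewrite [\sum_(0 <= i < size lam) _](big_cat_nat (leq0n s) (ltnW sd)) /=.
  rewrite [\sum_(0 <= i < size a) _](big_cat_nat (leq0n s)) /=; last first.
    by rewrite (leq_trans (ltnW sd)).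
  by rewrite totc /x big_split /=; ring.
Qed.

End Blocks.

Lemma nuop_profile (lam a : seq R) :
    lam != [::] -> a != [::] -> sorted <=%R lam -> sorted >=%R a ->
    (forall i, (i < size a)%N -> 0 < a`_i) ->
  size (nuop lam a) = size lam /\ exists w,
    profile (size lam) (size a) (nth 0 lam) (nth 0 a) w (nth 0 (nuop lam a)).
Proof.
move=> l0 a0 sl sa apos; rewrite /nuop; case: leqP => ad.
  by split; [apply: size_nuop_ge | apply: nuop_ge_profile].
set lam' := take _ _.
have sz : size lam' = size a by rewrite size_takel // ltnW.
have l'0 : lam' != [::] by rewrite -size_eq0 sz size_eq0.
have sl' : sorted <=%R lam' by apply: take_sorted.
have size_le : (size lam' <= size a)%N by rewrite sz.
split; first by rewrite size_cat size_nuop_ge // sz size_drop subnKC // ltnW.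
have [w [hd _ lv pre dr tot]] := nuop_ge_profile l'0 sl' sa apos size_le.
move: hd lv pre dr tot; rewrite sz minnn => hd lv pre dr tot.
set v' := nth 0 (nuop_ge lam' a) in hd pre dr tot.
set v := nth 0 (_ ++ _).
have vE i : (i < size a)%N -> v i = v' i.
  by move=> ia; rewrite /v nth_cat size_nuop_ge // sz ia.
have lE i : (i < size a)%N -> lam'`_i = lam`_i by move=> ia; rewrite nth_take.
have svE p : (p <= size a)%N -> \sum_(0 <= i < p) v i = \sum_(0 <= i < p) v' i.
  by move=> pa; apply: eq_big_nat => i /andP[_ ip]; rewrite vE // (leq_trans ip).
have slE p : (p <= size a)%N -> \sum_(0 <= i < p) (lam`_i + a`_i) =
    \sum_(0 <= i < p) (lam'`_i + a`_i).
  by move=> pa; apply: eq_big_nat => i /andP[_ ip]; rewrite lE // (leq_trans ip).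
exists w; split; rewrite (minn_idPr (ltnW ad)) //.
- by move=> i ia; rewrite vE // hd // lE.
- move=> i /andP[ai id_]; rewrite /v nth_cat size_nuop_ge // sz ltnNge ai /=.
  by rewrite nth_drop subnKC.
- by move=> p pa; rewrite svE // slE // pre.
- by move=> i ia wlt; rewrite svE ?(ltnW ia) // slE ?(ltnW ia) // dr.
- rewrite svE // tot; congr (_ + _); apply: eq_big_nat => i /andP[_ ia].
  by rewrite lE.
Qed.

End WaterFilling.

(** * Order-theoretic optimality of profiles *)

Section ProfileOptimality.
Variable R : realType.

(** Abel summation. *)
Lemma sum_by_parts n (w e : nat -> R) :
  \sum_(0 <= i < n.+1) w i * e i = w n * \sum_(0 <= i < n.+1) e i +
    \sum_(0 <= i < n) (w i - w i.+1) * \sum_(0 <= j < i.+1) e j.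
Proof.
elim: n => [|n IH]; first by rewrite !big_nat1 big_geq // addr0.
rewrite big_nat_recr //= IH [X in _ = _ * X + _]big_nat_recr //=.
rewrite [X in _ = _ + X]big_nat_recr //=; ring.
Qed.

Lemma abel_ge0 n (w e : nat -> R) :
    (forall i, (i.+1 < n)%N ->
       0 <= (w i - w i.+1) * \sum_(0 <= j < i.+1) e j) ->
    \sum_(0 <= i < n) e i = 0 ->
  0 <= \sum_(0 <= i < n) w i * e i.
Proof.
case: n => [|n] we e0; first by rewrite big_geq.
rewrite sum_by_parts e0 mulr0 add0r big_nat_cond sumr_ge0 // => i.
by rewrite andbT => /andP[_ id_]; apply: we.
Qed.

Variables (d k : nat) (l a w v : nat -> R).
Hypothesis prof : profile d k l a w v.

Lemma profile_ge i : (i < d)%N -> l i <= v i.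
Proof.
move=> id_; case: (ltnP i (minn d k)) => ik.
  by rewrite (profile_head prof) // le_max lexx orbT.
by rewrite (profile_tail prof) // ik.
Qed.

Let level_le i j : (i <= j < minn d k)%N -> w j <= w i.
Proof.
elim: j => [|j IH] /andP[ij jn]; first by move: ij; rewrite leqn0 => /eqP ->.
move: ij; rewrite leq_eqVlt => /orP[/eqP -> //|ij].
by rewrite (le_trans (profile_level prof jn)) // IH //; lia.
Qed.

Lemma profile_sum :
  \sum_(0 <= i < d) v i = \sum_(0 <= i < d) l i + \sum_(0 <= i < k) a i.
Proof.
have nd := geq_minl d k.
rewrite !(big_cat_nat (leq0n _) nd) /= (profile_total prof) addrAC; congr (_ + _ + _).
by apply: eq_big_nat => i ik; rewrite (profile_tail prof).
Qed.

(** With [p] the first position where the level is at most [t], all entries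
    before [p] exceed [t], and the others exceed it only where they equal [l].
    The level drops at [p], or [p] is one of the two ends, so the first [p]
    entries of [v] have the same sum as those of [l + a].  The first alternative
    is the case where the level stays above [t] on all [d] positions; then the
    whole of [a] counts, not only its first [p] entries. *)
Lemma profile_pos_part t :
    \sum_(0 <= i < d) Num.max (v i - t) 0 =
      \sum_(0 <= i < d) (l i - t) + \sum_(0 <= i < k) a i
  \/ exists2 p, (p <= minn d k)%N & \sum_(0 <= i < d) Num.max (v i - t) 0 =
      \sum_(0 <= i < p) (l i - t) + \sum_(0 <= i < p) a i +
      \sum_(p <= i < d) Num.max (l i - t) 0.
Proof.
set n := minn d k; have nd : (n <= d)%N := geq_minl d k.
pose p := find (fun i => w i <= t) (iota 0 n).
have pn : (p <= n)%N by rewrite -[X in (_ <= X)%N](size_iota 0 n) find_size.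
have wlo i : (i < p)%N -> t < w i.
  move=> ip; have := before_find 0%N ip; rewrite nth_iota ?(leq_trans ip) // add0n.
  by rewrite leNgt => /negbFE.
have whi i : (p <= i < n)%N -> w i <= t.
  move=> /andP[pi iN]; have pN := leq_ltn_trans pi iN.
  have : has (fun i => w i <= t) (iota 0 n) by rewrite has_find size_iota.
  move=> /(nth_find 0%N); rewrite -/p nth_iota // add0n.
  by apply: le_trans; rewrite level_le // pi.
have slo : \sum_(0 <= i < p) Num.max (v i - t) 0 = \sum_(0 <= i < p) (v i - t).
  apply: eq_big_nat => i /andP[_ ip]; apply/max_idPl; rewrite subr_ge0.
  rewrite (profile_head prof) ?(leq_trans ip) // le_max ltW ?wlo //.
have shi : \sum_(p <= i < d) Num.max (v i - t) 0 =
           \sum_(p <= i < d) Num.max (l i - t) 0.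
  apply: eq_big_nat => i /andP[pi id_]; case: (ltnP i n) => iN.
    rewrite (profile_head prof) // addr_maxl -maxA [X in Num.max X _](_ : _ = w i - t) //.
    by apply/max_idPr; rewrite le_max subr_le0 whi ?orbT // pi.
  by rewrite (profile_tail prof) // iN.
rewrite (big_cat_nat (leq0n p) (leq_trans pn nd)) /= slo shi.
have sumB q (f : nat -> R) : \sum_(0 <= i < q) (f i - t) = \sum_(0 <= i < q) f i - t *+ q.
  by rewrite sumrB sumr_const_nat subn0.
have [pN|Np] := ltnP p n.
  right; exists p => //; congr (_ + _).
  rewrite !sumB addrAC -big_split; congr (_ - _).
  case: {wlo whi slo shi} p pn pN (wlo) (whi) => [|p] pn pN plo phi; first by rewrite !big_geq.
  rewrite -(profile_drop prof) // (le_lt_trans (phi p.+1 _) (plo p _)) //.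
  by rewrite leqnn.
have {pn Np} pN : p = n by apply/eqP; rewrite eqn_leq pn.
have tot : \sum_(0 <= i < p) (v i - t) = \sum_(0 <= i < p) (l i - t) + \sum_(0 <= i < k) a i.
  by rewrite !sumB pN (profile_total prof); ring.
have [dk|kd] := leqP d k.
  left; rewrite tot; have -> : p = d by rewrite pN /n; apply/minn_idPl.
  by rewrite [X in _ + X = _]big_geq // addr0.
right; exists p; first by rewrite pN.
by rewrite tot; have -> : p = k by rewrite pN /n; apply/minn_idPr/ltnW.
Qed.

(** First-order optimality of [v] for the sum of squares on the convex set of
    admissible [x].  Replacing the factor [v i] by the level [w i] only decreases
    the sum, as the two differ only where [v i = l i <= x i]; Abel summation then
    pairs each drop of [w] with a partial sum of [x - v] at a position where
    the partial sum of [v] is the smallest admissible one. *)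
Lemma profile_variational (x : nat -> R) :
    (forall i, (i < d)%N -> l i <= x i) ->
    (forall p, (p <= minn d k)%N ->
       \sum_(0 <= i < p) (l i + a i) <= \sum_(0 <= i < p) x i) ->
    \sum_(0 <= i < minn d k) l i + \sum_(0 <= i < k) a i <= \sum_(0 <= i < minn d k) x i ->
    \sum_(0 <= i < d) x i = \sum_(0 <= i < d) l i + \sum_(0 <= i < k) a i ->
  0 <= \sum_(0 <= i < d) v i * (x i - v i).
Proof.
set n := minn d k; have nd : (n <= d)%N := geq_minl d k.
move=> xl xpre xtot xsum.
have cat (f : nat -> R) : \sum_(0 <= i < d) f i =
    \sum_(0 <= i < n) f i + \sum_(n <= i < d) f i by apply: big_cat_nat.
have tail_ge0 i : (n <= i < d)%N -> 0 <= x i - l i.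
  by move=> /andP[_ id_]; rewrite subr_ge0 xl.
have tailE : \sum_(n <= i < d) (x i - l i) = 0.
  apply/le_anti/andP; split; last first.
    by rewrite big_nat_cond sumr_ge0 // => i; rewrite andbT => /tail_ge0.
  by move: xtot xsum; rewrite sumrB (cat x) (cat l); lra.
(* The first n entries already carry the whole mass, so x agrees with l after n. *)
have tail0 i : (n <= i < d)%N -> x i = l i.
  move=> ind; apply/eqP; rewrite eq_le xl ?(proj2 (andP ind)) // andbT.
  have /andP[ni id_] := ind; rewrite -subr_le0 -tailE.
  rewrite (big_cat_nat ni (ltnW id_)) /= (big_ltn id_) addrCA lerDl addr_ge0 //.
    rewrite big_nat_cond sumr_ge0 // => j; rewrite andbT => jni.
    by apply: tail_ge0; lia.
  rewrite big_nat_cond sumr_ge0 // => j; rewrite andbT => jni.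
  by apply: tail_ge0; lia.
have headE : \sum_(0 <= i < n) (x i - v i) = 0.
  move: xsum tailE; rewrite !sumrB (cat x) (cat l) (profile_total prof) -/n; lra.
rewrite cat [X in _ + X]big1_seq ?addr0; last first.
  move=> i /andP[_]; rewrite mem_index_iota => ind.
  by rewrite tail0 // (profile_tail prof) // subrr mulr0.
apply: le_trans (_ : 0 <= \sum_(0 <= i < n) w i * (x i - v i)) _.
  apply: abel_ge0 headE => i iN.
  have := profile_level prof iN; rewrite le_eqVlt => /orP[/eqP ->|wlt].
    by rewrite subrr mul0r.
  rewrite mulr_ge0 ?subr_ge0 ?(ltW wlt) //.
  by rewrite sumrB -(profile_drop prof) // subr_ge0 xpre // ltnW.
apply: ler_sum_nat => i /andP[_ iN]; rewrite -subr_ge0 -mulrBl.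
rewrite (profile_head prof) //; case: (leP (w i) (l i)) => wl; last by rewrite subrr mul0r.
by rewrite mulr_ge0 ?subr_ge0 // xl // (leq_trans iN).
Qed.

Lemma profile_gap_anti i j :
    (forall i j, (i <= j < d)%N -> l i <= l j) ->
  (i <= j < minn d k)%N -> v j - l j <= v i - l i.
Proof.
move=> lmon /andP[ij jn]; have iN := leq_ltn_trans ij jn.
have jd : (j < d)%N := leq_trans jn (geq_minl _ _).
have wm : w j <= w i by rewrite level_le // ij.
have lm : l i <= l j by rewrite lmon // ij.
rewrite !(profile_head prof) // !addr_maxl !subrr ge_max !le_max lexx orbT andbT.
by rewrite lerB.
Qed.

End ProfileOptimality.

(** * Majorization by T-transforms *)

Section Majorization.
Variable R : realType.

(** The elementary averaging step of the theory of majorization: the convex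
    combination of the identity and of the transposition of [i] and [j]. *)
Definition T_transform n (i j : 'I_n) (t : R) (z : 'I_n -> R) : 'I_n -> R := fun l =>
  if l == i then t * z i + (1 - t) * z j
  else if l == j then (1 - t) * z i + t * z j else z l.

Lemma T_transformE n (i j : 'I_n) (t : R) z l : i != j ->
  T_transform i j t z l = z l - (1 - t) * (z i - z j) * (l == i)%:R
                      + (1 - t) * (z i - z j) * (l == j)%:R.
Proof.
move=> ij; rewrite /T_transform; case: (eqVneq l i) => [->|li].
  by rewrite (negPf ij) /=; ring.
by case: (eqVneq l j) => [->|lj] /=; ring.
Qed.

Lemma sum_T_transform n (i j : 'I_n) (t : R) z (P : pred 'I_n) : i != j ->
  \sum_(l | P l) T_transform i j t z l = \sum_(l | P l) z l
     - (1 - t) * (z i - z j) * (P i)%:R + (1 - t) * (z i - z j) * (P j)%:R.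
Proof.
move=> ij; under eq_bigr do rewrite T_transformE //.
rewrite big_split sumrB /= -!mulr_sumr.
have E m : \sum_(l | P l) ((l == m)%:R : R) = (P m)%:R.
  rewrite big_mkcond (bigD1 m) //= eqxx big1 ?addr0; first by case: (P m).
  by move=> l /negPf ->; case: (P l).
by rewrite !E.
Qed.

(** A non-increasing [x] majorized by [y] is obtained from [y] by T-transforms.
    Let [j] be the first index with [y j < x j] and [i] the last one before it
    with [x i < y i]; moving the largest admissible mass from [i] to [j]
    keeps [y] non-increasing, keeps the partial sums dominating, and makes
    [x] and [y] agree at one more index. *)
Lemma majorization_ind n (P : ('I_n -> R) -> Prop) (x y : 'I_n -> R) :
    (forall (i j : 'I_n) (t : R) z, i != j -> 0 <= t -> t <= 1 -> P z ->
       P (T_transform i j t z)) ->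
    (forall i j : 'I_n, (i <= j)%N -> x j <= x i) ->
    (forall i j : 'I_n, (i <= j)%N -> y j <= y i) ->
    (forall p, \sum_(i < n | (i < p)%N) x i <= \sum_(i < n | (i < p)%N) y i) ->
    \sum_i x i = \sum_i y i ->
  P y -> P x.
Proof.
move=> Pmix xmon; move: {2}#|_| (leqnn #|[pred l | x l != y l]|) => N.
elim: N y => [|N IH] y.
  rewrite leqn0 => /eqP /card0_eq xy _ _ _; suff -> : x = y by [].
  by apply: funext => l; have := xy l; rewrite inE => /negbFE/eqP.
move=> cN ymon pre tot Py.
have [xy|] := pselect (forall l, x l = y l); first by rewrite (funext xy).
move=> neq.
have [j0 j0P] : exists j, y j < x j.
  apply: contrapT => noj; apply: neq => l; symmetry.
  have xley (l' : 'I_n) : 0 <= y l' - x l'.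
    by rewrite subr_ge0 leNgt; apply/negP => h; apply: noj; exists l'.
  apply/eqP; rewrite -subr_eq0; apply/eqP.
  have s0 : \sum_l' (y l' - x l') = 0 by rewrite sumrB tot subrr.
  by have /(_ l isT) := psumr_eq0P (fun l' _ => xley l') s0.
(* The index j receives mass and the index i gives it away. *)
have [j jP jmin] :=
  @arg_minnP _ j0 (fun j : 'I_n => y j < x j) (fun j : 'I_n => j : nat) j0P.
have below (l : 'I_n) : (l < j)%N -> x l <= y l.
  by move=> lj; rewrite leNgt; apply/negP => /jmin; rewrite leqNgt lj.
have [i0 /andP[i0j i0P]] : exists i : 'I_n, (i < j)%N && (x i < y i).
  apply: contrapT => noi; have := pre j.+1; rewrite leNgt => /negP; apply.
  rewrite (bigD1 j) //= [ltRHS](bigD1 j) //= ltr_leD //.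
  apply: ler_sum => l /andP[lj lnj]; rewrite leNgt; apply/negP => h; apply: noi.
  by exists l; rewrite h andbT ltn_neqAle -ltnS lj andbT.
have ij0P : (i0 < j)%N && (x i0 < y i0) by rewrite i0j.
have [i /andP[ij iP] imax] :=
  @arg_maxnP _ i0 (fun i : 'I_n => (i < j)%N && (x i < y i)) (fun i : 'I_n => i : nat) ij0P.
have mid (l : 'I_n) : (i < l)%N -> (l < j)%N -> y l = x l.
  move=> il lj; apply/le_anti; rewrite below // andbT leNgt; apply/negP => h.
  by have := imax l; rewrite lj h => /(_ isT) /=; rewrite leqNgt il.
have inj : i != j by rewrite -val_eqE /= ltn_eqF.
(* The largest transfer that keeps x i <= y i and y j <= x j. *)
pose e := Num.min (y i - x i) (x j - y j).
have xij : x j <= x i by apply: xmon; apply: ltnW.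
have yij : 0 < y i - y j by lra.
have e_i : e <= y i - x i by rewrite ge_min lexx.
have e_j : e <= x j - y j by rewrite ge_min lexx orbT.
have e0 : 0 < e by rewrite lt_min !subr_gt0 iP jP.
pose t := 1 - e / (y i - y j).
have tE : (1 - t) * (y i - y j) = e.
  by rewrite /t opprB addrCA subrr addr0 divfK ?gt_eqF.
pose y' := T_transform i j t y.
have y'E l : y' l = y l - e * (l == i)%:R + e * (l == j)%:R.
  by rewrite /y' T_transformE // tE.
have y'i : y' i = y i - e by rewrite y'E eqxx (negPf inj) mulr0 mulr1 addr0.
have y'j : y' j = y j + e.
  by rewrite y'E eqxx eq_sym (negPf inj) mulr0 mulr1 subr0.
have y'o l : l != i -> l != j -> y' l = y l.
  by move=> li lj; rewrite y'E (negPf li) (negPf lj) !mulr0 subr0 addr0.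
apply: (IH y').
- rewrite -ltnS; apply: leq_trans cN; apply: proper_card; apply/properP; split.
    apply/fintype.subsetP => l; rewrite !inE; apply: contraNN => /eqP xyl.
    have [li|li] := eqVneq l i; first by move: iP; rewrite -li xyl ltxx.
    have [lj|lj] := eqVneq l j; first by move: jP; rewrite -lj xyl ltxx.
    by rewrite y'o // xyl.
  have [h|h] := leP (y i - x i) (x j - y j).
    exists i; rewrite !inE; first by rewrite lt_eqF.
    by rewrite y'i /e (min_idPl h) opprB addrC subrK eqxx.
  exists j; rewrite !inE; first by rewrite gt_eqF.
  by rewrite y'j /e (min_idPr (ltW h)) addrC subrK eqxx.
- move=> p q pq.
  have [pi|pi] := eqVneq p i; have [qj|qj] := eqVneq q j; subst.
  + by rewrite y'i y'j; lra.
  + rewrite y'i; have [->|qi] := eqVneq q i; first by rewrite y'i.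
    rewrite y'o //; have iq : (i < q)%N.
      by rewrite ltn_neqAle pq andbT eq_sym; apply: contraNN qi => /eqP/val_inj ->.
    have [qj'|jq] := ltnP q j.
      by rewrite (mid q) //; have := xmon _ _ pq; lra.
    by have := ymon _ _ jq; lra.
  + rewrite y'j; have [->|pj] := eqVneq p j; first by rewrite y'j.
    rewrite y'o //; have [ip|pi'] := ltnP i p; last by have := ymon _ _ pi'; lra.
    have pj' : (p < j)%N.
      by rewrite ltn_neqAle pq andbT; apply: contraNN pj => /eqP/val_inj ->.
    by rewrite (mid p) //; have := xmon _ _ pq; lra.
  + have [qi|qi] := eqVneq q i; have [pj|pj] := eqVneq p j; subst.
    * by move: (leq_trans ij pq); rewrite ltnn.
    * by rewrite y'i y'o //; have := ymon _ _ pq; lra.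
    * by rewrite y'j y'o //; have := ymon _ _ pq; lra.
    * by rewrite !y'o //; apply: ymon.
- move=> p; rewrite /y' sum_T_transform // tE.
  have [jp|pj] := ltnP j p.
    by rewrite (ltn_trans ij jp) subrK.
  have [ip|pi] := ltnP i p; last by rewrite mulr0 subr0 addr0.
  rewrite mulr0 mulr1 addr0 lerBrDl -lerBrDr -sumrB (bigD1 i) //=.
  rewrite (le_trans e_i) // lerDl sumr_ge0 // => l /andP[lp _].
  by rewrite subr_ge0 below // (leq_trans lp).
- by rewrite /y' sum_T_transform // subrK.
- apply: Pmix => //; rewrite /t ?subr_ge0 ?gerBl.
    by rewrite ler_pdivrMr // mul1r; lra.
  by rewrite divr_ge0 ?ltW.
Qed.

(** Take for threshold the last entry [y p] of the prefix: there the positive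
    parts of [y] add up exactly to the prefix sum. *)
Lemma prefix_le_of_pos_part n (x y : 'I_n -> R) :
    (forall i j : 'I_n, (i <= j)%N -> y j <= y i) ->
    (forall t, \sum_i Num.max (x i - t) 0 <= \sum_i Num.max (y i - t) 0) ->
  forall p, \sum_(i < n | (i < p)%N) x i <= \sum_(i < n | (i < p)%N) y i.
Proof.
move=> ymon pos.
have main p (pn : (p < n)%N) :
    \sum_(i < n | (i < p.+1)%N) x i <= \sum_(i < n | (i < p.+1)%N) y i.
  pose o := Ordinal pn; pose t := y o.
  rewrite -(lerD2r (- \sum_(i < n | (i < p.+1)%N) t)) -!sumrB.
  apply: (le_trans _ (le_trans (pos t) _)).
    rewrite big_mkcond /=; apply: ler_sum => i _.
    by case: ifP => _; rewrite le_max lexx ?orbT.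
  rewrite [leRHS]big_mkcond /=; apply: ler_sum => i _; case: ltnP => ip.
    by rewrite (max_idPl _) // subr_ge0; apply: ymon.
  by rewrite (max_idPr _) // subr_le0; apply: ymon; apply: ltnW.
have full (f : 'I_n -> R) p : (n <= p)%N ->
    \sum_(i < n | (i < p)%N) f i = \sum_(i < n | (i < n)%N) f i.
  by move=> np; apply: eq_bigl => i; rewrite ltn_ord (leq_trans (ltn_ord i)).
case=> [|p]; first by rewrite !big_pred0.
case: (ltnP p n) => pn; first exact: main.
case: n x y ymon pos main full pn => [|n] x y ymon pos main full pn.
  by rewrite !big_ord0.
by rewrite !(full _ p.+1) ?(leqW pn) // main.
Qed.

End Majorization.

(** * Matrix identities over a numerical closed field *)

Section AdjointAlgebra.
Variable C : numClosedFieldType.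
Local Open Scope sesquilinear_scope.

Lemma adjM m n p (A : 'M[C]_(m, n)) (B : 'M[C]_(n, p)) : (A *m B)^t* = B^t* *m A^t*.
Proof. by rewrite trmx_mul map_mxM. Qed.

Lemma adjD m n (A B : 'M[C]_(m, n)) : (A + B)^t* = A^t* + B^t*.
Proof. by rewrite linearD map_mxD. Qed.

Lemma adjB m n (A B : 'M[C]_(m, n)) : (A - B)^t* = A^t* - B^t*.
Proof. by rewrite linearB map_mxB. Qed.

Lemma adjZ m n c (A : 'M[C]_(m, n)) : (c *: A)^t* = Num.conj c *: A^t*.
Proof. by rewrite linearZ map_mxZ. Qed.

Lemma adjE m n (A : 'M[C]_(m, n)) i j : A^t* i j = Num.conj (A j i).
Proof. by rewrite !mxE. Qed.

Lemma hermsymmx_adjP d (A : 'M[C]_d) : A \is hermsymmx <-> A^t* = A.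
Proof.
split; first by move/is_hermitianmxP; rewrite expr0 scale1r => <-.
by move=> E; apply/is_hermitianmxP; rewrite expr0 scale1r E.
Qed.

Lemma unitaryK d (U : 'M[C]_d) : U \is unitarymx -> U *m U^t* = 1%:M.
Proof. by move/unitarymxP. Qed.

Lemma unitaryKV d (U : 'M[C]_d) : U \is unitarymx -> U^t* *m U = 1%:M.
Proof. by move=> uU; apply: mulmx1C; apply: unitaryK. Qed.

Lemma unitary_mulK d (U X : 'M[C]_d) : U \is unitarymx -> X *m U *m U^t* = X.
Proof. by move=> uU; rewrite -mulmxA unitaryK // mulmx1. Qed.

Lemma unitary_mulKV d (U X : 'M[C]_d) : U \is unitarymx -> X *m U^t* *m U = X.
Proof. by move=> uU; rewrite -mulmxA unitaryKV // mulmx1. Qed.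

Lemma perm_unitary d (s : {perm 'I_d}) : (perm_mx s : 'M[C]_d) \is unitarymx.
Proof.
by apply/unitarymxP; rewrite tr_perm_mx map_perm_mx -perm_mxM mulgV perm_mx1.
Qed.

Lemma conjugate_adj d (U D : 'M[C]_d) : D^t* = D ->
  (U^t* *m D *m U)^t* = U^t* *m D *m U.
Proof. by move=> Dh; rewrite !adjM Dh trmxCK mulmxA. Qed.

Lemma conjugate_change d (S P D : 'M[C]_d) : S \is unitarymx ->
  (S *m P)^t* *m (S *m D *m S^t*) *m (S *m P) = P^t* *m D *m P.
Proof. by move=> uS; rewrite adjM !mulmxA !unitary_mulKV. Qed.

Lemma conjugate_inv d (U D A : 'M[C]_d) : U \is unitarymx ->
  U *m A *m U^t* = D -> A = U^t* *m D *m U.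
Proof.
by move=> uU <-; rewrite !mulmxA unitary_mulKV // unitaryKV // mul1mx.
Qed.

Lemma conjugate_mul d (U D E : 'M[C]_d) : U \is unitarymx ->
  (U^t* *m D *m U) *m (U^t* *m E *m U) = U^t* *m (D *m E) *m U.
Proof. by move=> uU; rewrite !mulmxA unitary_mulK. Qed.

Lemma conjugate_mulV d (U D E : 'M[C]_d) : U \is unitarymx ->
  (U *m D *m U^t*) *m (U *m E *m U^t*) = U *m (D *m E) *m U^t*.
Proof. by move=> uU; rewrite !mulmxA unitary_mulKV. Qed.

Lemma conjugateK d (U D : 'M[C]_d) : U \is unitarymx ->
  U *m (U^t* *m D *m U) *m U^t* = D.
Proof. by move=> uU; rewrite !mulmxA unitary_mulK // unitaryK // mul1mx. Qed.

Lemma conjugate_scalar d (U : 'M[C]_d) c : U \is unitarymx ->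
  U^t* *m c%:M *m U = c%:M.
Proof. by move=> uU; rewrite scalar_mxC -mulmxA unitaryKV // mulmx1. Qed.

Lemma trace_sub d (A B : 'M[C]_d) : \tr (A - B) = \tr A - \tr B.
Proof. exact: raddfB. Qed.

Lemma trace_sub_sqr d (A B : 'M[C]_d) :
  \tr ((B - A) *m (B - A)) = \tr (B *m B) + \tr (A *m A) - (\tr (A *m B)) *+ 2.
Proof.
rewrite mulmxBl !mulmxBr !trace_sub [\tr (B *m A)]mxtrace_mulC mulr2n; ring.
Qed.

Lemma trace_add_sqr d (A B : 'M[C]_d) :
  \tr ((A + B) *m (A + B)) = \tr (A *m A) + \tr (B *m B) + (\tr (A *m B)) *+ 2.
Proof.
rewrite mulmxDl !mulmxDr !mxtraceD [\tr (B *m A)]mxtrace_mulC mulr2n; ring.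
Qed.

Lemma trace_conjugate d (U D : 'M[C]_d) : U \is unitarymx ->
  \tr (U^t* *m D *m U) = \tr D.
Proof. by move=> uU; rewrite mxtrace_mulC mulmxA unitaryK // mul1mx. Qed.

Lemma trace_conjugate_mul d (U D Q : 'M[C]_d) :
  \tr (U^t* *m D *m U *m Q) = \tr (D *m (U *m Q *m U^t*)).
Proof. by rewrite -!mulmxA mxtrace_mulC !mulmxA. Qed.

Definition projector d (Q : 'M[C]_d) := Q^t* = Q /\ Q *m Q = Q.

Lemma projector_conj d (U Q : 'M[C]_d) : U \is unitarymx -> projector Q ->
  projector (U *m Q *m U^t*).
Proof.
move=> uU [Qh QQ]; split; first by rewrite !adjM trmxCK Qh mulmxA.
by rewrite !mulmxA unitary_mulKV // -[U *m Q *m Q]mulmxA QQ.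
Qed.

Lemma trace_projector_conj d (U Q : 'M[C]_d) : U \is unitarymx ->
  \tr (U *m Q *m U^t*) = \tr Q.
Proof. by move=> uU; rewrite mxtrace_mulC mulmxA unitaryKV // mul1mx. Qed.

Lemma projector_quad d (Q : 'M[C]_d) (g : 'cV[C]_d) : projector Q ->
  \tr (g *m g^t* *m Q) = \tr ((Q *m g)^t* *m (Q *m g)).
Proof.
move=> [Qh QQ]; rewrite -mulmxA mxtrace_mulC adjM Qh !mulmxA.
by rewrite -[_ *m Q *m Q]mulmxA QQ.
Qed.

(** One step of the Gram-Schmidt process, expressed on projectors. *)
Lemma projector_update d (Q : 'M[C]_d) (g h : 'cV[C]_d) n c :
    projector Q -> h = g - Q *m g -> h^t* *m h = n%:M -> c * n = 1 ->
    Num.conj c = c ->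
  [/\ projector (Q + c *: (h *m h^t*)), (Q + c *: (h *m h^t*)) *m g = g,
      forall f : 'cV[C]_d, Q *m f = f -> (Q + c *: (h *m h^t*)) *m f = f
    & \tr (Q + c *: (h *m h^t*)) = \tr Q + 1].
Proof.
move=> [Qh QQ] hE hh cn cc.
have Qh0 : Q *m h = 0 by rewrite hE mulmxBr mulmxA QQ subrr.
have hQ0 : h^t* *m Q = 0 by rewrite -Qh -adjM Qh0 trmx0 map_mx0.
have hg : h^t* *m g = n%:M.
  by rewrite -[g](subrK (Q *m g)) -hE mulmxDr hh mulmxA hQ0 mul0mx addr0.
split.
- split; first by rewrite adjD Qh adjZ cc adjM trmxCK.
  have QT : Q *m (h *m h^t*) = 0 by rewrite mulmxA Qh0 mul0mx.
  have TQ : h *m h^t* *m Q = 0 by rewrite -mulmxA hQ0 mulmx0.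
  have TT : h *m h^t* *m (h *m h^t*) = n *: (h *m h^t*).
    by rewrite mulmxA -[h *m _ *m h]mulmxA hh mul_mx_scalar -scalemxAl.
  rewrite mulmxDr !mulmxDl QQ -!scalemxAl -!scalemxAr TQ QT TT.
  by rewrite !scaler0 addr0 add0r !scalerA -mulrA cn mulr1.
- rewrite mulmxDl -scalemxAl -mulmxA hg mul_mx_scalar scalerA cn scale1r hE.
  by rewrite addrC subrK.
- move=> f Qf.
  have hf : h^t* *m f = 0 by rewrite -Qf mulmxA hQ0 mul0mx.
  by rewrite mulmxDl Qf -scalemxAl -mulmxA hf mulmx0 scaler0 addr0.
- by rewrite mxtraceD mxtraceZ mxtrace_mulC hh mxtrace_scalar mulr1n cn.
Qed.

(** A quarter turn away from the direction of the conjugate of [z]. *)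
Lemma unit_phase (z : C) : exists2 u, u * Num.conj u = 1 & u * z + Num.conj (u * z) = 0.
Proof.
have [->|z0] := eqVneq z 0.
  by exists 1; rewrite ?rmorph1 ?mulr1 // mulr0 rmorph0 addr0.
have n0 : `|z| != 0 by rewrite normr_eq0.
have cn : Num.conj `|z| = `|z| by apply/CrealP/normr_real.
have zz : z * Num.conj z = `|z| ^+ 2 by rewrite normCK.
exists ('i * Num.conj z / `|z|); rewrite !rmorphM /= fmorphV /= conjCi conjCK cn.
  rewrite [LHS](_ : _ = - ('i * 'i) * (z * Num.conj z) / `|z| ^+ 2); last by field.
  by rewrite -expr2 sqrCi opprK mul1r zz divff // expf_neq0.
by field.
Qed.

(** A unitary mixing of two columns keeps the sum of their rank-one matrices; only
    the cross term can disturb the norms, and the phase [u] controls it. *)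
Lemma rotate_pair d (g h : 'cV[C]_d) (al be u : C) :
    Num.conj al = al -> Num.conj be = be -> al ^+ 2 + be ^+ 2 = 1 ->
    u * Num.conj u = 1 ->
    let g' := al *: g + (be * u) *: h in let h' := be *: g - (al * u) *: h in
  g' *m g'^t* + h' *m h'^t* = g *m g^t* + h *m h^t* /\
  \tr (g' *m g'^t*) = al ^+ 2 * \tr (g *m g^t*) + be ^+ 2 * \tr (h *m h^t*) +
    al * be * (u * \tr (h *m g^t*) + Num.conj (u * \tr (h *m g^t*))).
Proof.
move=> alc bec ab1 uu g' h'; split.
  apply/matrixP => i j; rewrite !mxE !big_ord1 !mxE.
  rewrite !rmorphD !rmorphN !rmorphM /= alc bec.
  set gi := g i 0; set hi := h i 0; set gj := Num.conj _; set hj := Num.conj (h _ _).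
  rewrite [LHS](_ : _ = (al ^+ 2 + be ^+ 2) * (gi * gj) +
    (al ^+ 2 + be ^+ 2) * ((u * Num.conj u) * (hi * hj))); last by ring.
  by rewrite ab1 uu !mul1r.
have trE (x y : 'cV[C]_d) : \tr (x *m y^t*) = \sum_i x i 0 * Num.conj (y i 0).
  by apply: eq_bigr => i _; rewrite mxE big_ord1 !mxE.
rewrite !trE rmorphM rmorph_sum /= !mulr_sumr.
rewrite -[X in _ + al * be * X]big_split /= mulr_sumr -!big_split /=.
apply: eq_bigr => i _; rewrite !mxE !rmorphD !rmorphM /= alc bec conjCK.
set gi := g i 0; set hi := h i 0; set gj := Num.conj gi; set hj := Num.conj hi.
rewrite [LHS](_ : _ = al ^+ 2 * (gi * gj) + be ^+ 2 * ((u * Num.conj u) * (hi * hj)) +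
  al * be * (u * (hi * gj) + Num.conj u * (hj * gi))); last by ring.
by rewrite uu mul1r.
Qed.

End AdjointAlgebra.

(** * Hermitian matrices as spectra *)

Section Spectra.
Variable R : realType.
Local Notation C := R[i].
Local Open Scope sesquilinear_scope.

Definition normsq (z : C) : R := complex.Re z ^+ 2 + complex.Im z ^+ 2.

Lemma normsq_ge0 z : 0 <= normsq z.
Proof. by rewrite addr_ge0 ?sqr_ge0. Qed.

Lemma mul_conj_normsq z : z * Num.conj z = (normsq z)%:C.
Proof. by rewrite -normCK add_Re2_Im2. Qed.

Lemma conj_mul_normsq z : Num.conj z * z = (normsq z)%:C.
Proof. by rewrite mulrC mul_conj_normsq. Qed.

Lemma normsq_eq0 z : normsq z = 0 -> z = 0.
Proof.
move=> z0; apply/eqP; rewrite -normr_eq0 -sqrf_eq0 -add_Re2_Im2.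
by rewrite -/(normsq z) z0.
Qed.

Lemma modulus_sqr z : modulus z ^+ 2 = normsq z.
Proof.
apply: complexI; rewrite rmorphXn /= /modulus RRe_real ?normr_real //.
by rewrite -add_Re2_Im2.
Qed.

Lemma vnorm_sqr d (x : 'cV[C]_d) : vnorm x ^+ 2 = \sum_i normsq (x i 0).
Proof.
rewrite /vnorm sqr_sqrtr; first by apply: eq_bigr => i _; rewrite modulus_sqr.
by apply: sumr_ge0 => i _; rewrite sqr_ge0.
Qed.

Lemma conj_real (x : R) : Num.conj (x%:C : C) = x%:C.
Proof. exact: conjc_real. Qed.

Lemma sum_real (I : finType) (P : pred I) (f : I -> R) :
  \sum_(i | P i) (f i)%:C = (\sum_(i | P i) f i)%:C :> C.
Proof. by rewrite rmorph_sum. Qed.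

Definition rdiag d (x : 'I_d -> R) : 'M[C]_d := diag_mx (\row_i (x i)%:C).

(** The Hermitian matrix with eigenvalues [x] whose eigenvectors are the columns
    of the adjoint of [U]. *)
Definition spec d (U : 'M[C]_d) (x : 'I_d -> R) : 'M[C]_d := U^t* *m rdiag x *m U.

Lemma rdiag_adj d (x : 'I_d -> R) : (rdiag x)^t* = rdiag x.
Proof.
rewrite /rdiag tr_diag_mx map_diag_mx; congr diag_mx.
by apply/matrixP => i j; rewrite !mxE /= conj_real.
Qed.

Lemma rdiagD d (x y : 'I_d -> R) : rdiag x + rdiag y = rdiag (fun i => x i + y i).
Proof. by apply/matrixP => i j; rewrite !mxE -mulrnDl -rmorphD. Qed.

Lemma rdiagN d (x : 'I_d -> R) : - rdiag x = rdiag (fun i => - x i).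
Proof. by apply/matrixP => i j; rewrite !mxE -mulNrn -rmorphN. Qed.

Lemma rdiagB d (x y : 'I_d -> R) : rdiag x - rdiag y = rdiag (fun i => x i - y i).
Proof. by rewrite rdiagN rdiagD. Qed.

Lemma specB d (U : 'M[C]_d) x y : spec U x - spec U y = spec U (fun i => x i - y i).
Proof. by rewrite /spec -rdiagB mulmxBr mulmxBl. Qed.

Lemma spec_const d (U : 'M[C]_d) (c : R) : U \is unitarymx ->
  spec U (fun=> c) = (c%:C)%:M.
Proof.
move=> uU; rewrite /spec; have -> : rdiag (fun=> c : R) = (c%:C)%:M :> 'M_d.
  by apply/matrixP => i j; rewrite !mxE.
exact: conjugate_scalar.
Qed.

Lemma spec_adj d (U : 'M[C]_d) x : (spec U x)^t* = spec U x.
Proof. exact/conjugate_adj/rdiag_adj. Qed.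

Lemma trace_spec_mul d (U Q : 'M[C]_d) x :
  \tr (spec U x *m Q) = \sum_i (x i)%:C * (U *m Q *m U^t*) i i.
Proof.
rewrite /spec trace_conjugate_mul /rdiag mul_diag_mx.
by apply: eq_bigr => i _; rewrite !mxE.
Qed.

(** The roots of the characteristic polynomial of a real diagonal matrix are its
    entries, and the characteristic polynomial is invariant under conjugation. *)
Lemma eigvals_perm d (A : 'M[C]_d) (U : 'M[C]_d) (x : 'I_d -> R) :
  U \is unitarymx -> A = spec U x ->
  perm_eq (eigvals A) [seq x i | i <- enum 'I_d].
Proof.
move=> uU AE; rewrite /eigvals; case: closed_field_poly_normal => rs /= rsE.
rewrite /decr perm_sort.
suff : perm_eq rs [seq (x i)%:C | i <- enum 'I_d].
  by move=> /(perm_map (@complex.Re R)) /=; rewrite -map_comp (eq_map (g := x)).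
apply: prod_XsubC_eq; move: rsE.
rewrite (monicP (char_poly_monic _)) scale1r => <-.
rewrite big_map big_enum /=.
have -> : char_poly A = char_poly (rdiag x).
  rewrite /char_poly; have -> : char_poly_mx A =
      map_mx polyC (U^t*) *m char_poly_mx (rdiag x) *m map_mx polyC U.
    rewrite /char_poly_mx AE /spec !map_mxM mulmxBr mulmxBl; congr (_ - _).
    rewrite -mulmxA mul_scalar_mx -scalemxAr -map_mxM unitaryKV //.
    by rewrite map_mx1 scalemx1.
  by rewrite !det_mulmx mulrAC -det_mulmx -map_mxM unitaryKV // map_mx1 det1 mul1r.
rewrite char_poly_trig ?diag_mx_is_trig //.
by apply: eq_bigr => i _; rewrite !mxE eqxx.
Qed.

Lemma size_eigvals d (A : 'M[C]_d) : size (eigvals A) = d.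
Proof.
rewrite /eigvals; case: closed_field_poly_normal => rs /= rsE.
rewrite /decr size_sort size_map; have := size_char_poly A.
rewrite rsE (monicP (char_poly_monic _)) scale1r size_prod_XsubC.
by case.
Qed.

Lemma sorted_decr (x : seq R) : sorted >=%R (decr x).
Proof. by apply: sort_sorted => y z; apply: le_total. Qed.

Lemma perm_fun n (f g : 'I_n -> R) :
    perm_eq [seq f i | i <- enum 'I_n] [seq g i | i <- enum 'I_n] ->
  exists s : {perm 'I_n}, forall i, f i = g (s i).
Proof.
have sz : size [seq g i | i <- enum 'I_n] == n by rewrite size_map size_enum_ord.
move=> fg; have /tuple_permP[s sE] : perm_eq [seq f i | i <- enum 'I_n] (Tuple sz) by [].
exists s => i; have := congr1 (fun t => nth 0 t i) sE.
rewrite (nth_map i) ?size_enum_ord // nth_ord_enum => ->.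
rewrite -tnth_nth tnth_mktuple (tnth_nth 0) /= (nth_map i) ?size_enum_ord //.
by rewrite nth_ord_enum.
Qed.

Lemma rdiag_perm d (x : 'I_d -> R) (s : {perm 'I_d}) :
  rdiag (fun i => x (s i)) = perm_mx s *m rdiag x *m (perm_mx s)^t*.
Proof.
rewrite tr_perm_mx map_perm_mx -row_permE -col_permE.
by apply/matrixP => i j; rewrite !mxE (inj_eq perm_inj).
Qed.

Lemma spec_change d (S P : 'M[C]_d) (x y : 'I_d -> R) : S \is unitarymx ->
  rdiag y = S *m rdiag x *m S^t* -> spec (S *m P) y = spec P x.
Proof. by move=> uS yE; rewrite /spec yE; apply: conjugate_change. Qed.

Lemma map_nth_enum d (s : seq R) : size s = d ->
  [seq s`_i | i : 'I_d <- enum 'I_d] = s.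
Proof.
move=> sz; have := mkseq_nth 0 s; rewrite sz => {2}<-.
by rewrite /mkseq -val_enum_ord -map_comp.
Qed.

Lemma spectral_eigvals d (A : 'M[C]_d) : A^t* = A ->
  exists2 U, U \is unitarymx & A = spec U (fun i => (eigvals A)`_i).
Proof.
move=> /hermsymmx_adjP hA.
have := elimT (@orthomx_spectralP _ _ A) (hermitian_normalmx hA).
have := hermitian_spectral_diag_real hA; have := spectral_unitarymx A.
move: (spectralmx A) (spectral_diag A) => P sp uP /mxOverP sp_real.
rewrite (invmx_unitary uP) => AE0.
pose x (i : 'I_d) := complex.Re (sp 0 i).
have AE : A = spec P x.
  suff spE : sp = \row_i (x i)%:C by rewrite AE0 /spec /rdiag -spE.
  by apply/rowP => i; rewrite !mxE RRe_real.
have : perm_eq [seq (eigvals A)`_i | i : 'I_d <- enum 'I_d] [seq x i | i <- enum 'I_d].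
  by rewrite map_nth_enum ?size_eigvals //; apply: eigvals_perm uP AE.
move=> /perm_fun[s sE]; have uS := @perm_unitary C d s.
exists (perm_mx s *m P); first exact: (mul_unitarymx uS uP).
rewrite (funext sE : (fun i : 'I_d => (eigvals A)`_i) = _) AE.
by symmetry; apply: (spec_change _ uS); apply: rdiag_perm.
Qed.

Lemma sorted_nth_anti (x : seq R) i j : sorted >=%R x ->
  (i <= j < size x)%N -> x`_j <= x`_i.
Proof.
move=> sx /andP[ij jx].
apply: (sorted_leq_nth (leT := >=%R) _ _ 0 sx) => //.
- by move=> y z t /= zy tz; apply: le_trans zy.
- by move=> y /=.
- by rewrite inE; apply: leq_ltn_trans ij jx.
Qed.

(** The diagonal entry of a projector is the squared norm of its row, hence at
    least its own square. *)
Lemma projector_diag d (Q : 'M[C]_d) j : projector Q ->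
  Q j j = (complex.Re (Q j j))%:C /\ 0 <= complex.Re (Q j j) <= 1.
Proof.
move=> [Qh QQ]; set q := complex.Re _.
have QE : Q j j = (\sum_l normsq (Q j l))%:C.
  rewrite -sum_real -{1}QQ mxE; apply: eq_bigr => l _.
  by rewrite -mul_conj_normsq; congr (_ * _); rewrite -{1}Qh !mxE.
have qE : q = \sum_l normsq (Q j l) by rewrite /q QE.
have q0 : 0 <= q by rewrite qE sumr_ge0 // => l _; apply: normsq_ge0.
split; first by rewrite {1}QE qE.
have qq : q ^+ 2 <= q.
  have sE : normsq (Q j j) = q ^+ 2 by rewrite QE -qE /normsq /= expr0n addr0.
  rewrite [leRHS]qE (bigD1 j) //= sE lerDl.
  by apply: sumr_ge0 => l _; apply: normsq_ge0.
rewrite q0 leNgt; apply/negP => q1.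
by move: qq; rewrite expr2; nra.
Qed.

Lemma trace_spec_projector d (U Q : 'M[C]_d) x : U \is unitarymx -> projector Q ->
  exists q : 'I_d -> R, [/\ forall i, 0 <= q i <= 1,
    forall i, (U *m Q *m U^t*) i i = (q i)%:C,
    \tr Q = (\sum_i q i)%:C & \tr (spec U x *m Q) = (\sum_i x i * q i)%:C].
Proof.
move=> uU pQ; have pQ' := projector_conj uU pQ.
exists (fun i => complex.Re ((U *m Q *m U^t*) i i)).
split=> [i|i||]; try by have [] := projector_diag i pQ'.
- have -> : \tr Q = \tr (U *m Q *m U^t*).
    by rewrite mxtrace_mulC mulmxA unitaryKV // mul1mx.
  by rewrite -sum_real; apply: eq_bigr => i _; have [] := projector_diag i pQ'.
- rewrite trace_spec_mul -sum_real; apply: eq_bigr => i _; rewrite rmorphM /=.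
  by have [E _] := projector_diag i pQ'; rewrite {1}E.
Qed.

(** Ky Fan's principle in threshold form: the diagonal of a projector in any
    orthonormal basis has entries between 0 and 1. *)
Lemma trace_projector_le d (U Q : 'M[C]_d) x t : U \is unitarymx -> projector Q ->
  complex.Re (\tr (spec U x *m Q)) - t * complex.Re (\tr Q) <=
    \sum_i Num.max (x i - t) 0.
Proof.
move=> uU pQ; have [q [q01 _ -> ->]] := trace_spec_projector x uU pQ.
rewrite /= mulr_sumr -sumrB; apply: ler_sum => i _; have /andP[q0 q1] := q01 i.
by rewrite -mulrBl le_max; have [h|h] := leP (x i - t) 0; apply/orP;
  [right|left]; nra.
Qed.

Lemma adj_self d (h : 'cV[C]_d) : h^t* *m h = ((vnorm h ^+ 2)%:C)%:M.
Proof.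
apply/matrixP => i j; rewrite !ord1 vnorm_sqr !mxE eqxx mulr1n -sum_real.
by apply: eq_bigr => l _; rewrite !mxE conj_mul_normsq.
Qed.

Lemma trace_tens_projector d (g : 'cV[C]_d) Q : projector Q ->
  \tr (tens g g *m Q) = (vnorm (Q *m g) ^+ 2)%:C.
Proof.
move=> pQ; rewrite /tens (projector_quad g pQ) adj_self.
by rewrite mxtrace_scalar mulr1n.
Qed.

Lemma tens_adj d (g : 'cV[C]_d) : (tens g g)^t* = tens g g.
Proof. by rewrite /tens adjM trmxCK. Qed.

Lemma vnorm_eq0 d (h : 'cV[C]_d) : vnorm h ^+ 2 = 0 -> h = 0.
Proof.
rewrite vnorm_sqr => s0; apply/colP => i; rewrite mxE; apply: normsq_eq0.
by have /(_ i isT) := psumr_eq0P (fun i _ => normsq_ge0 _) s0.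
Qed.

(** The rank of the projector is controlled through its trace, the only form in
    which it is needed. *)
Lemma span_projector d (gs : seq 'cV[C]_d) : exists Q : 'M[C]_d,
  [/\ projector Q, {in gs, forall g, Q *m g = g} &
      complex.Re (\tr Q) <= (size gs)%:R].
Proof.
elim: gs => [|g gs [Q [pQ Qgs trQ]]].
  exists 0; split=> //; last by rewrite raddf0.
  by split; rewrite ?mulmx0 // trmx0 map_mx0.
pose h := g - Q *m g.
have [h0|/eqP h0] := eqVneq h 0.
  exists Q; split=> //; last by rewrite (le_trans trQ) // ler_nat /=.
  move=> g'; rewrite inE => /orP[/eqP ->|/Qgs //].
  by apply/esym/eqP; rewrite -subr_eq0 -/h h0.
pose n := vnorm h ^+ 2.
have n0 : n%:C != 0 :> C.
  by rewrite (fmorph_eq0 (real_complex R)); apply/eqP => /vnorm_eq0.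
have cn : (n^-1)%:C * n%:C = 1 :> C by rewrite fmorphV mulVf.
have [pQ' Qg Qf trQ'] :=
  projector_update pQ (erefl h) (adj_self h) cn (conj_real n^-1).
exists (Q + (n^-1)%:C *: (h *m h^t*)); split=> //.
  by move=> g'; rewrite inE => /orP[/eqP -> //|/Qgs]; apply: Qf.
by rewrite trQ' raddfD /= -natr1 lerD2r.
Qed.

(** * Traces of frame operators and lower bounds for positive parts *)

Lemma trace_frame_projector d k (G : 'I_k -> 'cV[C]_d) Q : projector Q ->
  \tr (frame_op G *m Q) = (\sum_i vnorm (Q *m G i) ^+ 2)%:C.
Proof.
move=> pQ; rewrite /frame_op mulmx_suml raddf_sum -sum_real.
by apply: eq_bigr => i _; apply: trace_tens_projector.
Qed.

Lemma projector1 d : projector (1%:M : 'M[C]_d).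
Proof. by split; rewrite ?mulmx1 // trmx1 map_mx1. Qed.

Lemma trace_frame d k (G : 'I_k -> 'cV[C]_d) :
  \tr (frame_op G) = (\sum_i vnorm (G i) ^+ 2)%:C.
Proof.
rewrite -[frame_op G]mulmx1 trace_frame_projector; last exact: projector1.
by congr (_ %:C); apply: eq_bigr => i _; rewrite mul1mx.
Qed.

Lemma trace_spec d (U : 'M[C]_d) x : U \is unitarymx ->
  \tr (spec U x) = (\sum_i x i)%:C.
Proof.
move=> uU; rewrite /spec trace_conjugate // mxtrace_diag -sum_real.
by apply: eq_bigr => i _; rewrite mxE.
Qed.

Lemma frame_adj d k (G : 'I_k -> 'cV[C]_d) : (frame_op G)^t* = frame_op G.
Proof.
rewrite /frame_op linear_sum map_mx_sum /=.
by apply: eq_bigr => i _; apply: tens_adj.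
Qed.

Lemma sum_prefix d p (f : nat -> R) : (p <= d)%N ->
  \sum_(0 <= i < p) f i = \sum_(i < d | (i < p)%N) f i.
Proof. by move=> pd; rewrite big_mkord (big_ord_widen d). Qed.

Lemma sum_suffix d p (f : nat -> R) :
  \sum_(p <= i < d) f i = \sum_(i < d | (p <= i)%N) f i.
Proof. by rewrite big_geq_mkord. Qed.

Lemma spec_apply d (V : 'M[C]_d) (i : 'I_d) (Q : 'M[C]_d) : V \is unitarymx ->
  Q *m (row i V)^t* = (row i V)^t* -> (V *m Q *m V^t*) i i = 1.
Proof.
move=> uV Qv.
have : (row i V *m Q *m (row i V)^t*) 0 0 = 1.
  rewrite -mulmxA Qv; have := congr1 (fun M : 'M_d => M i i) (unitaryK uV).
  rewrite !mxE eqxx mulr1n => <-; apply: eq_bigr => j _; by rewrite !mxE.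
move=> <-; rewrite -row_mul !mxE; apply: eq_bigr => j _; by rewrite !mxE.
Qed.

Section KyFan.
Variables (d k : nat) (U V : 'M[C]_d) (x : 'I_d -> R) (l : nat -> R).
Variable G : 'I_k -> 'cV[C]_d.
Hypotheses (uU : U \is unitarymx) (uV : V \is unitarymx).
Hypothesis lmon : forall i j, (i <= j < d)%N -> l i <= l j.
Hypothesis xE : spec U x = spec V l + frame_op G.

Lemma sum_spec_add :
  \sum_(i < d) x i = \sum_(i < d) l i + \sum_i vnorm (G i) ^+ 2.
Proof.
apply: complexI; rewrite rmorphD /= -(trace_spec x uU).
by rewrite -(trace_spec (fun i : 'I_d => l i) uV) -trace_frame xE mxtraceD.
Qed.

Lemma pos_part_ge_trace t :
  \sum_(i < d) (l i - t) + \sum_i vnorm (G i) ^+ 2 <= \sum_i Num.max (x i - t) 0.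
Proof.
rewrite sumrB addrAC -sum_spec_add -sumrB; apply: ler_sum => i _.
by rewrite le_max lexx.
Qed.

(** If all eigenvalues of S from index [p] on exceed [t], the trace is enough.
    Otherwise [l p <= t], and S + S_G is tested against the projector [Q] onto the
    span of the first [p] vectors of [G] and of the eigenvectors of S above [t].
    On the vectors of [G] the projector captures the full squared norms.  Its
    diagonal [q] in the eigenbasis of S is 1 on the indices above [t] and has
    total at most [p] on the others, so the contribution of S is smallest when
    this mass fills the first [p] indices. *)
Lemma pos_part_ge_prefix p t : (p <= d)%N -> (p <= k)%N ->
  \sum_(i < d | (i < p)%N) (l i - t) + \sum_(i < k | (i < p)%N) vnorm (G i) ^+ 2
  + \sum_(i < d | (p <= i)%N) Num.max (l i - t) 0 <= \sum_i Num.max (x i - t) 0.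
Proof.
move=> pd pk.
have [tail|[pd' lpt]] : (forall i, (p <= i < d)%N -> t < l i) \/ ((p < d)%N /\ l p <= t).
  have [pd'|dp] := ltnP p d; last by left=> i; lia.
  have [lpt|tlp] := leP (l p) t; first by right.
  by left=> i pid; rewrite (lt_le_trans tlp) // lmon.
  apply: le_trans (pos_part_ge_trace t).
  rewrite addrAC; apply: lerD.
    rewrite [leRHS](bigID (fun i : 'I_d => i < p)%N) /= lerD2l.
    rewrite (eq_bigl (fun i : 'I_d => ~~ (i < p)%N)); last by move=> i; rewrite leqNgt.
    apply: ler_sum => i; rewrite -leqNgt => pi; rewrite (max_idPl _) // subr_ge0.
    by rewrite ltW // tail // pi ltn_ord.
  rewrite [leRHS](bigID (fun i : 'I_k => i < p)%N) /= lerDl.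
  by apply: sumr_ge0 => i _; rewrite sqr_ge0.
(* As l p <= t, the set E of eigenvalues above t lies beyond the first p indices. *)
pose E := [pred i : 'I_d | t < l i].
pose gs := [seq (row i V)^t* | i <- enum E] ++
  [seq G i | i <- enum [pred i : 'I_k | (i < p)%N]].
have [Q [pQ Qgs trQ]] := span_projector gs.
have QE i : E i -> Q *m (row i V)^t* = (row i V)^t*.
  move=> Ei; apply: Qgs; rewrite mem_cat; apply/orP; left.
  by apply: (map_f (fun i => (row i V)^t*)); rewrite mem_enum.
have QG (i : 'I_k) : (i < p)%N -> Q *m G i = G i.
  move=> ip; apply: Qgs; rewrite mem_cat; apply/orP; right.
  by apply: map_f; rewrite mem_enum.
have := trace_projector_le x t uU pQ.
have [q [q01 qE qtr qsp]] := trace_spec_projector (fun i : 'I_d => l i) uV pQ.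
rewrite xE mulmxDl mxtraceD qsp trace_frame_projector // qtr raddfD /=.
apply: le_trans.
have sizegs : (size gs)%:R = \sum_(i < d) ((i < p)%N || E i)%:R :> R.
  rewrite size_cat !size_map -!cardE natrD addrC.
  have nE (i : 'I_d) : ((i < p)%N || E i)%:R = (i < p)%N%:R + (E i)%:R :> R.
    case: ltnP => ip /=; last by rewrite add0r.
    by rewrite ltNge (le_trans (lmon _) lpt) ?addr0 // (ltnW ip).
  rewrite (eq_bigr _ (fun i _ => nE i)) big_split /= -!natr_sum.
  congr (_%:R + _%:R); last by rewrite -sum1_card big_mkcond.
  rewrite -sum1_card big_mkcond /=.
  transitivity p.
    rewrite -big_mkcond /= -(big_ord_widen _ (fun=> 1%N) pk) sum1_card card_ord //.
  rewrite -[LHS]card_ord -sum1_card (big_ord_widen _ (fun=> 1%N) pd) big_mkcond.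
  by apply: eq_bigr => i _; case: ltnP.
have h0 : 0 <= t - l p by rewrite subr_ge0.
have trle : \sum_i q i <= \sum_(i < d) ((i < p)%N || E i)%:R.
  by rewrite -sizegs; move: trQ; rewrite qtr.
(* Comparison with the optimal mass distribution; t - l p is the Lagrange
   multiplier of the constraint on the trace of Q. *)
have point (i : 'I_d) : ((i < p)%N || E i)%:R * (l i - t) +
    (t - l p) * (((i < p)%N || E i)%:R - q i) <= l i * q i - t * q i.
  have /andP[q0 q1] := q01 i.
  case: (boolP (E i)) => [Ei|nE].
    have -> : q i = 1 by apply: complexI; rewrite -qE spec_apply // QE.
    by rewrite orbT !mulr1 mul1r subrr mulr0 addr0.
  case: ltnP => ip /=.
    have : l i <= l p by rewrite lmon // (ltnW ip).
    nra.
  have : l p <= l i by rewrite lmon // ip ltn_ord.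
  nra.
rewrite mulr_sumr [leRHS]addrAC [leLHS]addrAC -sumrB; apply: lerD; last first.
  rewrite [leRHS](bigID (fun i : 'I_k => i < p)%N) /=.
  rewrite (eq_bigr (fun i => vnorm (Q *m G i) ^+ 2)) ?lerDl; last by move=> i /QG ->.
  by apply: sumr_ge0 => i _; rewrite sqr_ge0.
have bal : 0 <= \sum_(i < d) (t - l p) * (((i < p)%N || E i)%:R - q i).
  by rewrite -mulr_sumr sumrB mulr_ge0 // subr_ge0.
apply: le_trans (ler_sum _ (fun i _ => point i)).
rewrite [leRHS]big_split /= big_mkcond [X in _ + X]big_mkcond /=.
rewrite -[leLHS]big_split /=.
rewrite ler_wpDr //; apply: ler_sum => i _.
case: ltnP => ip /=; first by rewrite mul1r addr0.
rewrite add0r; case: (ltP t (l i)) => tl; rewrite ?mul1r ?mul0r.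
  by rewrite (max_idPl _) // subr_ge0 ltW.
by rewrite (max_idPr _) // subr_le0.
Qed.

End KyFan.

(** * Diagonals of Hermitian matrices and the trace inequality *)

Lemma herm_diag_real d (A : 'M[C]_d) i : A^t* = A -> A i i = (complex.Re (A i i))%:C.
Proof. by move=> Ah; rewrite RRe_real // CrealE -{2}Ah adjE. Qed.

Lemma trace_spec_spec d (U : 'M[C]_d) x y : U \is unitarymx ->
  \tr (spec U x *m spec U y) = (\sum_i x i * y i)%:C.
Proof.
move=> uU; rewrite /spec conjugate_mul // trace_conjugate // /rdiag mul_diag_mx -sum_real.
by apply: eq_bigr => i _; rewrite !mxE eqxx mulr1n rmorphM.
Qed.

Lemma spec_projector d (U : 'M[C]_d) (P : pred 'I_d) : U \is unitarymx ->
  projector (spec U (fun i => (P i)%:R)).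
Proof.
move=> uU; split; first exact: spec_adj.
pose D := rdiag (fun i => (P i)%:R : R).
suff DD : D *m D = D by rewrite /spec -/D (conjugate_mul _ _ uU) DD.
apply/matrixP => i j; rewrite /D /rdiag mul_diag_mx !mxE.
by case: eqP => [->|_]; rewrite ?mulr0n ?mulr0 // !mulr1n; case: (P _);
  rewrite ?rmorph1 ?rmorph0 ?mulr1 ?mulr0.
Qed.

Lemma trace_spec_pred d (U A : 'M[C]_d) (P : pred 'I_d) :
  \tr (A *m spec U (fun i => (P i)%:R)) = \sum_(i | P i) (U *m A *m U^t*) i i.
Proof.
rewrite mxtrace_mulC trace_spec_mul [RHS]big_mkcond; apply: eq_bigr => i _.
by case: (P i); rewrite ?rmorph1 ?rmorph0 ?mul1r ?mul0r.
Qed.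

Lemma conj_herm d (U A : 'M[C]_d) : A^t* = A -> (U *m A *m U^t*)^t* = U *m A *m U^t*.
Proof. by move=> Ah; rewrite !adjM trmxCK Ah mulmxA. Qed.

(** Schur's theorem: the diagonal of a Hermitian matrix is majorized by its
    spectrum.  The projector is the one onto the first [p] basis vectors, and
    the threshold is the eigenvalue number [p]. *)
Lemma diag_prefix_le d (U W : 'M[C]_d) (x : nat -> R) p :
    U \is unitarymx -> W \is unitarymx ->
    (forall i j, (i <= j < d)%N -> x j <= x i) -> (p <= d)%N ->
  \sum_(i < d | (i < p)%N) complex.Re ((U *m spec W x *m U^t*) i i) <=
  \sum_(i < d | (i < p)%N) x i.
Proof.
move=> uU uW xmon pd; set A := spec W _; pose P := [pred i : 'I_d | (i < p)%N].
have diagE i : (U *m A *m U^t*) i i = (complex.Re ((U *m A *m U^t*) i i))%:C.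
  exact/herm_diag_real/conj_herm/spec_adj.
have trE : \tr (A *m spec U (fun i => (P i)%:R)) =
    (\sum_(i | P i) complex.Re ((U *m A *m U^t*) i i))%:C.
  by rewrite trace_spec_pred -sum_real; apply: eq_bigr => i _; rewrite -diagE.
have [pd'|dp] := ltnP p d; last first.
  have PT i : P i = true by rewrite /= (leq_trans (ltn_ord i)).
  rewrite (eq_bigl predT) // [leRHS](eq_bigl predT) //.
  suff /complexI -> : (\sum_i complex.Re ((U *m A *m U^t*) i i))%:C =
      (\sum_(i < d) x i)%:C :> C.
    by [].
  rewrite -(trace_spec (fun i : 'I_d => x i) uW) -(trace_projector_conj _ uU) -sum_real.
  by apply: eq_bigr => i _; rewrite -diagE.
have := trace_projector_le x (x p) uW (spec_projector P uU).
rewrite -/A trE trace_spec // /= => h.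
rewrite -(lerD2r (- (x p * \sum_i (P i)%:R))); apply: le_trans h _.
rewrite mulr_sumr -sumrN [X in _ + X](bigID P) /= [X in _ + (_ + X)]big1 ?addr0; last first.
  by move=> i /negPf ->; rewrite mulr0 oppr0.
rewrite -big_split [leRHS]big_mkcond /=; apply: ler_sum => i _.
case: ltnP => ip; first by rewrite mulr1 (max_idPl _) // subr_ge0 xmon // (ltnW ip).
by rewrite (max_idPr _) // subr_le0 xmon // ip /=.
Qed.

Lemma frame_eigenvalue_ge0 d k (W : 'M[C]_d) x (G : 'I_k -> 'cV[C]_d) i :
  W \is unitarymx -> spec W x = frame_op G -> 0 <= x i.
Proof.
move=> uW BE; have pQ := spec_projector (pred1 i) uW.
have := trace_frame_projector G pQ; rewrite -BE trace_spec_spec // => /complexI.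
rewrite (bigD1 i) //= eqxx mulr1 big1 ?addr0; last first.
  by move=> j /negPf ->; rewrite mulr0.
by move=> ->; apply: sumr_ge0 => j _; rewrite sqr_ge0.
Qed.

(** The squared norms of the vectors are majorized by the spectrum of the frame
    operator: the case S = 0 of [pos_part_ge_prefix]. *)
Lemma frame_prefix_le d k (W : 'M[C]_d) (x : nat -> R) (G : 'I_k -> 'cV[C]_d) p :
    W \is unitarymx -> spec W x = frame_op G ->
    (forall i j, (i <= j < d)%N -> x j <= x i) ->
    (p <= d)%N -> (p <= k)%N ->
  \sum_(i < k | (i < p)%N) vnorm (G i) ^+ 2 <= \sum_(i < d | (i < p)%N) x i.
Proof.
move=> uW BE xmon pd pk.
pose z (i : nat) : R := 0.
have zE : spec W (fun i : 'I_d => x i) = spec W (fun i : 'I_d => z i) + frame_op G.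
  by rewrite spec_const // raddf0 add0r.
have [pd'|dp] := ltnP p d; last first.
  rewrite [leRHS](eq_bigl predT); last by move=> i; rewrite (leq_trans (ltn_ord i)).
  rewrite (sum_spec_add uW uW zE) [X in X + _]big1 // add0r.
  rewrite [leRHS](bigID (fun i : 'I_k => i < p)%N) /= lerDl.
  by apply: sumr_ge0 => i _; rewrite sqr_ge0.
have x0 : 0 <= x p := frame_eigenvalue_ge0 (Ordinal pd') uW BE.
have := @pos_part_ge_prefix d k W W (fun i => x i) z G uW uW (fun _ _ _ => lexx _)
  zE p (x p) pd pk.
rewrite [X in _ + _ + X]big1 ?addr0; last first.
  by move=> i _; rewrite sub0r (max_idPr _) // oppr_le0.
rewrite sumrB [X in X - _ + _]big1 // sub0r addrC.
move=> h.
rewrite -(lerD2r (- \sum_(i < d | (i < p)%N) x p)) -[leRHS]sumrB.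
apply: le_trans h _; rewrite [leRHS]big_mkcond /=; apply: ler_sum => i _.
case: ltnP => ip; first by rewrite (max_idPl _) // subr_ge0 xmon // (ltnW ip).
by rewrite (max_idPr _) // subr_le0 xmon // ip /=.
Qed.

(** If the diagonal in some orthonormal basis is already the spectrum, the sum of
    squares of all entries is exhausted by the diagonal. *)
Lemma spec_of_diag d (U W : 'M[C]_d) x : U \is unitarymx -> W \is unitarymx ->
    (forall i, complex.Re ((U *m spec W x *m U^t*) i i) = x i) ->
  spec W x = spec U x.
Proof.
move=> uU uW dx; set A := spec W x; set B := U *m A *m U^t*.
have Bh : B^t* = B by apply/conj_herm/spec_adj.
have BB : \tr (B *m B) = (\sum_i \sum_j normsq (B i j))%:C.
  rewrite -sum_real; apply: eq_bigr => i _; rewrite mxE -sum_real.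
  by apply: eq_bigr => j _; rewrite -mul_conj_normsq -adjE Bh.
have AA : \tr (B *m B) = (\sum_i x i * x i)%:C.
  rewrite -(trace_spec_spec _ _ uW) -/A -(trace_projector_conj (A *m A) uU).
  by rewrite /B (conjugate_mulV A A uU).
have dB i : B i i = (x i)%:C by rewrite herm_diag_real // dx.
have off i j : i != j -> B i j = 0.
  move=> ij; apply: normsq_eq0.
  have /complexI := etrans (esym BB) AA.
  rewrite -[RHS]addr0; under eq_bigr => l _ do rewrite (bigD1 l) //= {1}dB.
  rewrite big_split /=.
  have -> : \sum_l normsq (x l)%:C = \sum_l x l * x l.
    by apply: eq_bigr => l _; rewrite /normsq /= expr0n addr0 expr2.
  move=> /addrI s0.
  have p1 l : true -> 0 <= \sum_(m | m != l) normsq (B l m).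
    by move=> _; apply: sumr_ge0 => m _; apply: normsq_ge0.
  have /(_ i isT) s1 := psumr_eq0P p1 s0.
  have /(_ j) := psumr_eq0P (fun m _ => normsq_ge0 _) s1.
  by rewrite eq_sym => /(_ ij).
suff BE : B = rdiag x by exact: (conjugate_inv uU BE).
apply/matrixP => i j; rewrite /rdiag [RHS]mxE [in RHS]mxE.
by case: eqVneq => [<-|ij]; rewrite ?mulr1n ?dB // off.
Qed.

(** Forgetting the matrix expression behind the diagonal entries turns the
    manipulation of their partial sums into plain real arithmetic. *)
Lemma abstract_fun n (f : 'I_n -> R) : exists g : 'I_n -> R, forall i, f i = g i.
Proof. by exists f. Qed.

(** Rearrangement inequality for the trace of a product of Hermitian matrices S
    and B, with the equality case.  Let [eta] be the non-increasing spectrum of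
    B - S in an eigenbasis, and [b], [s] the diagonals of B and S in that
    basis, so [eta = b - s].  By Schur's theorem for B and for -S, the partial sums
    of [e = m - l - eta] are nonnegative, and Abel summation gives
    sum [eta e >= 0].  Expanding tr (B - S)^2 turns this into
      2 (tr (S B) - sum [l m]) = 2 sum [eta e] + sum [e^2].
    Equality forces [e = 0], hence equality of all partial sums in both uses
    of Schur's theorem, hence [b = m] and [s = l]; then S and B are diagonal in
    this basis. *)
Lemma trace_mul_ge_rearranged d (V W : 'M[C]_d) (l m : nat -> R) :
    V \is unitarymx -> W \is unitarymx ->
    (forall i j, (i <= j < d)%N -> l i <= l j) ->
    (forall i j, (i <= j < d)%N -> m j <= m i) ->
  \sum_(i < d) l i * m i <= complex.Re (\tr (spec V l *m spec W m)) /\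
  (complex.Re (\tr (spec V l *m spec W m)) = \sum_(i < d) l i * m i ->
   exists U, [/\ U \is unitarymx, spec V l = spec U l & spec W m = spec U m]).
Proof.
move=> uV uW lmon mmon; set S := spec V _; set B := spec W _; set T := complex.Re _.
have Sh : S^t* = S by apply: spec_adj.
have Bh : B^t* = B by apply: spec_adj.
have [|U uU HE] := @spectral_eigvals d (B - S); first by rewrite adjB Sh Bh.
set eta := nth 0 (eigvals (B - S)).
have etaE : spec U (fun i : 'I_d => eta i) = B - S by rewrite HE.
have eta_mon i j : (i <= j < d)%N -> eta j <= eta i.
  by move=> ij; apply: sorted_nth_anti; rewrite ?size_eigvals // sorted_decr.
have [b bE] := abstract_fun (fun i => complex.Re ((U *m B *m U^t*) i i)).
have [s sE] := abstract_fun (fun i => complex.Re ((U *m S *m U^t*) i i)).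
have bs (i : 'I_d) : eta i = b i - s i.
  rewrite -bE -sE -raddfB /=; have := congr1 (fun M => (U *m M *m U^t*) i i) etaE.
  rewrite /spec (conjugateK _ uU) mulmxBr mulmxBl !mxE eqxx mulr1n.
  by move=> /(congr1 (@complex.Re R)).
have bpre p : (p <= d)%N -> \sum_(i < d | (i < p)%N) b i <= \sum_(i < d | (i < p)%N) m i.
  by move=> pd; under eq_bigr do rewrite -bE; apply: diag_prefix_le.
have spre p : (p <= d)%N -> \sum_(i < d | (i < p)%N) l i <= \sum_(i < d | (i < p)%N) s i.
  move=> pd; have := @diag_prefix_le d U V (fun i => - l i) p uU uV _ pd.
  have -> : spec V (fun i : 'I_d => - l i) = - S by rewrite /S /spec -rdiagN mulmxN mulNmx.
  rewrite sumrN => h; rewrite -lerN2; apply: le_trans (h _); last first.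
    by move=> i j ij; rewrite lerN2 lmon.
  rewrite -sumrN; apply: ler_sum => i _.
  rewrite -sE mulmxN mulNmx; set M := _ *m U^t*.
  by rewrite [(- M) i i]mxE; case: (M i i) => ? ?.
pose e i := m i - l i - eta i.
have epre p : (p <= d)%N -> \sum_(0 <= i < p) e i =
   (\sum_(i < d | (i < p)%N) m i - \sum_(i < d | (i < p)%N) b i) +
   (\sum_(i < d | (i < p)%N) s i - \sum_(i < d | (i < p)%N) l i).
  move=> pd; rewrite (sum_prefix _ pd) -!sumrB -big_split; apply: eq_bigr => i _ /=.
  by rewrite /e bs; ring.
have trS : \tr S = (\sum_(i < d) l i)%:C := trace_spec (fun i : 'I_d => l i) uV.
have trB : \tr B = (\sum_(i < d) m i)%:C := trace_spec (fun i : 'I_d => m i) uW.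
have trSS : \tr (S *m S) = (\sum_(i < d) l i * l i)%:C by apply: trace_spec_spec.
have trBB : \tr (B *m B) = (\sum_(i < d) m i * m i)%:C by apply: trace_spec_spec.
have e0 : \sum_(0 <= i < d) e i = 0.
  rewrite big_mkord !sumrB; apply/eqP; rewrite subr_eq0; apply/eqP/complexI.
  rewrite -(trace_spec _ uU) etaE trace_sub trS trB.
  by rewrite rmorphB.
have X0 : 0 <= \sum_(0 <= i < d) eta i * e i.
  apply: abel_ge0 e0 => i id_; rewrite mulr_ge0 //.
    by rewrite subr_ge0 eta_mon // leqnSn.
  by rewrite epre ?(ltnW id_) // addr_ge0 // subr_ge0 ?bpre ?spre // ltnW.
(* The trace of the square of B - S, computed in the basis U and by expansion. *)
have key : 2 * (T - \sum_(i < d) l i * m i) =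
    2 * (\sum_(i < d) eta i * e i) + \sum_(i < d) e i ^+ 2.
  have HH : \sum_(i < d) eta i * eta i =
     \sum_(i < d) m i * m i + \sum_(i < d) l i * l i - 2 * T.
    have := trace_spec_spec (fun i : 'I_d => eta i) (fun i : 'I_d => eta i) uU.
    rewrite etaE trace_sub_sqr trBB trSS => /(congr1 (@complex.Re R)).
    by rewrite /T; case: (\tr (S *m B)) => t1 t2 /= <-; ring.
  have : \sum_(i < d) (2 * (eta i * e i) + e i ^+ 2) =
     \sum_(i < d) (m i * m i + l i * l i - 2 * (l i * m i) - eta i * eta i).
    by apply: eq_bigr => i _; rewrite /e; ring.
  rewrite !big_split /= !sumrN -!mulr_sumr HH => ->; ring.
have sq0 : 0 <= \sum_(i < d) e i ^+ 2 by apply: sumr_ge0 => i _; rewrite sqr_ge0.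
rewrite big_mkord in X0.
split; first lra.
move=> TE.
have /psumr_eq0P e2 : \sum_(i < d) e i ^+ 2 = 0 by lra.
have ez p : (p <= d)%N -> \sum_(0 <= i < p) e i = 0.
  move=> pd; rewrite (sum_prefix _ pd) big1 // => i _; apply/eqP.
  by rewrite -sqrf_eq0 e2 // => j _; rewrite sqr_ge0.
have step (f : 'I_d -> R) (i : 'I_d) : f i =
    \sum_(j < d | (j < i.+1)%N) f j - \sum_(j < d | (j < i)%N) f j.
  rewrite (bigD1 i) //= [X in _ + X - _](eq_bigl (fun j : 'I_d => j < i)%N) ?addrK //.
  by move=> j; rewrite ltnS ltn_neqAle andbC.
have eqpre p : (p <= d)%N ->
   \sum_(i < d | (i < p)%N) b i = \sum_(i < d | (i < p)%N) m i /\
   \sum_(i < d | (i < p)%N) s i = \sum_(i < d | (i < p)%N) l i.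
  move=> pd; have := bpre p pd; have := spre p pd; have := epre p pd.
  by rewrite ez //; split; lra.
exists U; split; first exact: uU.
- apply: spec_of_diag => // i; rewrite sE (step s) (step (fun i => l i)).
  by rewrite (eqpre i.+1 (ltn_ord i)).2 (eqpre i (ltnW (ltn_ord i))).2.
- apply: spec_of_diag => // i; rewrite bE (step b) (step (fun i => m i)).
  by rewrite (eqpre i.+1 (ltn_ord i)).1 (eqpre i (ltnW (ltn_ord i))).1.
Qed.

(** * Frames with prescribed norms and frame operator *)

Lemma trace_rank_one d (g : 'cV[C]_d) : \tr (g *m g^t*) = (vnorm g ^+ 2)%:C.
Proof. by rewrite mxtrace_mulC adj_self mxtrace_scalar mulr1n. Qed.

(** With the phase that makes the cross term imaginary, a rotation of two vectors
    performs a T-transform on their squared norms. *)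
Lemma rotate_vectors d (g h : 'cV[C]_d) t : 0 <= t -> t <= 1 ->
  exists g' h' : 'cV[C]_d, [/\ tens g' g' + tens h' h' = tens g g + tens h h,
    vnorm g' ^+ 2 = t * vnorm g ^+ 2 + (1 - t) * vnorm h ^+ 2 &
    vnorm h' ^+ 2 = (1 - t) * vnorm g ^+ 2 + t * vnorm h ^+ 2].
Proof.
move=> t0 t1; have t1' : 0 <= 1 - t by rewrite subr_ge0.
pose al : C := (Num.sqrt t)%:C; pose be : C := (Num.sqrt (1 - t))%:C.
have al2 : al ^+ 2 = t%:C by rewrite -rmorphXn /= sqr_sqrtr.
have be2 : be ^+ 2 = (1 - t)%:C by rewrite -rmorphXn /= sqr_sqrtr.
have ab : al ^+ 2 + be ^+ 2 = 1 by rewrite al2 be2 -rmorphD /= addrC subrK.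
have [u uu uz] := unit_phase (\tr (h *m g^t*)).
have [tE trE] := rotate_pair g h (conj_real _ : Num.conj al = al)
  (conj_real _ : Num.conj be = be) ab uu.
move: trE; rewrite uz mulr0 addr0 al2 be2 !trace_rank_one -!rmorphM -rmorphD /=.
move=> /complexI gE.
exists (al *: g + (be * u) *: h), (be *: g - (al * u) *: h); split=> //.
have := congr1 (fun M : 'M_d => \tr M) tE.
rewrite !mxtraceD !trace_rank_one -!rmorphD /= => /complexI; rewrite gE; lra.
Qed.

Definition eigvec d (U : 'M[C]_d) (i : 'I_d) : 'cV[C]_d := (row i U)^t*.

Lemma inner_eigvec d (U : 'M[C]_d) i j : U \is unitarymx ->
  inner (eigvec U i) (eigvec U j) = (i == j)%:R.
Proof.
move=> uU; have := congr1 (fun M : 'M_d => M j i) (unitaryK uU).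
rewrite !mxE eq_sym => <-; apply: eq_bigr => l _.
by rewrite /eigvec !mxE /= conjCK mulrC.
Qed.

Lemma vnorm_inner d (g : 'cV[C]_d) : inner g g = (vnorm g ^+ 2)%:C.
Proof. by rewrite vnorm_sqr -sum_real; apply: eq_bigr => i _; rewrite mul_conj_normsq. Qed.

Lemma spec_sum_tens d (U : 'M[C]_d) x :
  spec U x = \sum_i (x i)%:C *: tens (eigvec U i) (eigvec U i).
Proof.
apply/matrixP => i j; rewrite /spec /rdiag mul_mx_diag summxE mxE.
apply: eq_bigr => l _; rewrite /tens /eigvec trmxCK !mxE big_ord1 !mxE; ring.
Qed.

Lemma sum_truncate (Z : zmodType) n d (F : nat -> Z) : (n <= d)%N ->
    (forall i, (n <= i < d)%N -> F i = 0) ->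
  \sum_(0 <= i < d) F i = \sum_(0 <= i < n) F i.
Proof.
move=> nd F0; rewrite (big_cat_nat (leq0n n) nd) /= [X in _ + X]big1_seq ?addr0 //.
by move=> i /andP[_]; rewrite mem_index_iota => /F0.
Qed.

(** The constructive half of the Schur-Horn theorem for frames: start from scaled
    eigenvectors, padded by zero vectors, and rotate along the T-transforms
    that lead from the spectrum to [a]. *)
Lemma frame_exists d k (V : 'M[C]_d) (m : nat -> R) (a : 'I_k -> R) :
    V \is unitarymx ->
    (forall i, (i < d)%N -> 0 <= m i) -> (forall i, (k <= i < d)%N -> m i = 0) ->
    (forall i j, (i <= j < minn d k)%N -> m j <= m i) ->
    (forall i j : 'I_k, (i <= j)%N -> a j <= a i) -> (forall i, 0 <= a i) ->
    (forall p, (p <= minn d k)%N ->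
       \sum_(i < k | (i < p)%N) a i <= \sum_(0 <= i < p) m i) ->
    \sum_i a i = \sum_(i < d) m i ->
  exists G : 'I_k -> 'cV[C]_d,
    frame_op G = spec V m /\ forall i, vnorm (G i) ^+ 2 = a i.
Proof.
move=> uV m0 mk mmon amon a0 pre tot.
set n := minn d k in mmon pre *.
have nd : (n <= d)%N := geq_minl _ _; have nk : (n <= k)%N := geq_minr _ _.
pose y i : R := if (i < d)%N then m i else 0.
have yk : \sum_(i < k) y i = \sum_(0 <= i < n) m i.
  rewrite -(big_mkord xpredT y) (sum_truncate nk).
    by apply: eq_big_nat => i /andP[_ iN]; rewrite /y (leq_trans iN).
  by move=> i /andP[ni ik]; rewrite /y ifF //; lia.
have md : \sum_(i < d) m i = \sum_(0 <= i < n) m i.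
  rewrite -(big_mkord xpredT m) (sum_truncate nd) //.
  by move=> i /andP[ni id_]; rewrite mk //; lia.
pose P (z : 'I_k -> R) := exists G : 'I_k -> 'cV[C]_d,
    frame_op G = spec V m /\ forall i, vnorm (G i) ^+ 2 = z i.
apply: (@majorization_ind R k P a (fun i => y i)) => //.
- move=> i j t z ij t0 t1 [G [GE Gz]].
  have [g' [h' [tE gE hE]]] := rotate_vectors (G i) (G j) t0 t1.
  exists (fun l => if l == i then g' else if l == j then h' else G l); split.
    rewrite -GE /frame_op (bigD1 i) //= (bigD1 j) 1?eq_sym //= eqxx.
    rewrite [in RHS](bigD1 i) //= [in RHS](bigD1 j) 1?eq_sym //=.
    rewrite (negPf ij) eqxx.
    rewrite !addrA tE; congr (_ + _); apply: eq_bigr => l /andP[li lj].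
    by rewrite (negPf li) (negPf lj).
  move=> l; rewrite /T_transform; case: eqP => _; first by rewrite gE !Gz.
  by case: eqP => _; rewrite ?hE !Gz.
- move=> i j ij; rewrite /y; case: ltnP => jd; last first.
    by case: ltnP => // id_; apply: m0.
  by rewrite (leq_ltn_trans ij jd) mmon // ij /n leq_min jd ltn_ord.
- move=> p; have [pn|np] := leqP p n.
    apply: le_trans (pre p pn) _; rewrite (sum_prefix _ (leq_trans pn nk)).
    apply: ler_sum => i ip; rewrite /y ifT //; exact: leq_trans (leq_trans ip pn) nd.
  apply: (@le_trans _ _ (\sum_i a i)).
    by rewrite [leRHS](bigID (fun i : 'I_k => i < p)%N) /= lerDl sumr_ge0.
  rewrite tot md -yk (bigID (fun i : 'I_k => i < p)%N) /= [X in _ + X]big1 ?addr0 //.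
  move=> i; rewrite -leqNgt => pi; rewrite /y ifF //.
  by have := ltn_ord i; rewrite /n in np *; lia.
- by rewrite tot md yk.
pose F (i : nat) : 'M[C]_d := if insub i is Some o
  then (m i)%:C *: tens (eigvec V (o : 'I_d)) (eigvec V o) else 0.
pose w (i : nat) : 'cV[C]_d := if insub i is Some o
  then (Num.sqrt (m i))%:C *: (eigvec V (o : 'I_d)) else 0.
have wF i : tens (w i) (w i) = F i.
  rewrite /w /F; case: insubP => [o od oi|_]; last by rewrite /tens mul0mx.
  rewrite /tens adjZ conj_real -scalemxAl -scalemxAr scalerA -rmorphM /= -expr2.
  by rewrite sqr_sqrtr // m0 // -oi.
have FE (o : 'I_d) : F o = (m o)%:C *: tens (eigvec V o) (eigvec V o).
  by rewrite /F valK.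
exists (fun i => w i); split.
  rewrite /frame_op (eq_bigr (fun i : 'I_k => F i)) => [|i _]; last exact: wF.
  rewrite spec_sum_tens -(eq_bigr _ (fun o _ => FE o)).
  rewrite -(big_mkord xpredT F) -[in RHS](big_mkord xpredT F).
  rewrite (sum_truncate nk) ?(sum_truncate nd) //.
    move=> i /andP[ni id_]; rewrite (FE (Ordinal id_)) /= mk ?scale0r //.
    by rewrite /n in ni; lia.
  by move=> i ni; rewrite /F insubF //; rewrite /n in ni; lia.
move=> i; apply: complexI; rewrite -trace_rank_one -/(tens _ _) wF /F /y.
case: insubP => [o od oi|/negPf ->]; last by rewrite linear0.
rewrite od mxtraceZ trace_rank_one -rmorphM; congr (_%:C).
have -> : vnorm (eigvec V o) ^+ 2 = 1; last by rewrite mulr1.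
by apply: complexI; rewrite -vnorm_inner inner_eigvec // eqxx.
Qed.

(** * Unitarily invariant norms and majorization *)

Section UnitarilyInvariantNorm.
Variables (d : nat) (N : 'M[C]_d -> R).
Hypotheses (normN : is_norm N) (invN : unitarily_invariant N).

Lemma norm_spec (U : 'M[C]_d) x : U \is unitarymx -> N (spec U x) = N (rdiag x).
Proof. by move=> uU; apply: invN; rewrite ?trmxC_unitary. Qed.

Lemma norm_perm (x : 'I_d -> R) (s : {perm 'I_d}) :
  N (rdiag (fun i => x (s i))) = N (rdiag x).
Proof. by rewrite rdiag_perm invN ?trmxC_unitary ?perm_unitary. Qed.

Lemma normZ (c : R) A : 0 <= c -> N (c%:C *: A) = c * N A.
Proof.
have [_ -> _] := normN; move=> c0; congr (_ * _).
by rewrite /modulus ger0_norm ?ler0c.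
Qed.

Lemma norm_ge0 A : 0 <= N A.
Proof.
have [tri _ _] := normN; have N0 : N 0 = 0.
  by have := normZ 0 (lexx 0); rewrite mul0r scale0r.
have := tri A (- A); rewrite subrr N0.
have -> : N (- A) = N A.
  have [_ homo _] := normN.
  by rewrite -scaleN1r homo /modulus normrN1 /= mul1r.
lra.
Qed.

(** A T-transform of a diagonal matrix is a convex combination of the matrix and
    of its conjugate by a transposition.  Under strict convexity equality leaves
    only the cases where the T-transform is trivial or is that transposition. *)
Lemma norm_rdiag_majorized (x y : 'I_d -> R) :
    (forall i j : 'I_d, (i <= j)%N -> x j <= x i) ->
    (forall i j : 'I_d, (i <= j)%N -> y j <= y i) ->
    (forall p, \sum_(i < d | (i < p)%N) x i <= \sum_(i < d | (i < p)%N) y i) ->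
    \sum_i x i = \sum_i y i ->
  N (rdiag x) <= N (rdiag y) /\
  (strictly_convex N -> N (rdiag x) = N (rdiag y) ->
   exists s : {perm 'I_d}, forall i, x i = y (s i)).
Proof.
move=> xmon ymon pre tot.
pose P z := N (rdiag z) <= N (rdiag y) /\
  (strictly_convex N -> N (rdiag z) = N (rdiag y) ->
   exists s : {perm 'I_d}, forall i, z i = y (s i)).
apply: (@majorization_ind R d P x y) => //; last first.
  by split=> // _ _; exists 1%g => i; rewrite perm1.
move=> i j t z ij t0 t1 [zy zstrict].
have [tri homo _] := normN.
pose s := tperm i j; pose z' l := z (s l).
have t1' : 0 <= 1 - t by rewrite subr_ge0.
have mixE : rdiag (T_transform i j t z) = t%:C *: rdiag z + (1 - t)%:C *: rdiag z'.
  apply/matrixP => p q; rewrite !mxE; case: eqP => _; last first.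
    by rewrite !mulr0n !mulr0 addr0.
  rewrite !mulr1n -!rmorphM -rmorphD; congr (_%:C); rewrite /T_transform /z' /s.
  case: tpermP => [->|->|/eqP/negPf -> /eqP/negPf ->].
  - by rewrite eqxx.
  - by rewrite eq_sym (negPf ij) eqxx addrC.
  - ring.
have z'N : N (rdiag z') = N (rdiag z) by apply: norm_perm.
have mixle : N (rdiag (T_transform i j t z)) <= N (rdiag z).
  rewrite mixE (le_trans (tri _ _)) // !normZ // z'N.
  by rewrite -mulrDl addrC subrK mul1r.
split; first exact: le_trans mixle zy.
move=> sc mixN; have zN : N (rdiag z) = N (rdiag y).
  by apply/le_anti; rewrite zy -mixN mixle.
have [s' s'E] := zstrict sc zN.
have mixz : T_transform i j t z = z ->
    exists s : {perm 'I_d}, forall l, T_transform i j t z l = y (s l).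
  by move=> ->; exists s'.
(* Degenerate T-transforms only permute the entries. *)
have [tz|tz] := eqVneq t 0.
  exists (s * s')%g => l; rewrite permM -s'E.
  have := congr1 (fun M : 'M_d => M l l) mixE.
  by rewrite tz scale0r add0r subr0 scale1r !mxE eqxx !mulr1n => /complexI.
have [tz1|tz1] := eqVneq t 1.
  apply: mixz; apply: funext => l; have := congr1 (fun M : 'M_d => M l l) mixE.
  by rewrite tz1 subrr scale0r addr0 scale1r !mxE eqxx !mulr1n => /complexI.
have [zz|zz] := eqVneq (rdiag z) (rdiag z').
  apply: mixz; apply: funext => l; have := congr1 (fun M : 'M_d => M l l) mixE.
  rewrite -zz -scalerDl -rmorphD addrC subrK scale1r !mxE eqxx !mulr1n.
  by move=> /complexI.
pose n := N (rdiag z).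
have n0 : 0 < n.
  rewrite lt_neqAle norm_ge0 andbT eq_sym; apply/eqP => n0.
  have [_ _ def] := normN; move: zz; rewrite (def _ n0) (def (rdiag z')) ?eqxx //.
  by rewrite z'N.
have ni0 : 0 <= n^-1 by rewrite invr_ge0 ltW.
have nC0 : (n^-1)%:C != 0 :> C.
  by rewrite (fmorph_eq0 (real_complex R)) invr_eq0 gt_eqF.
have scaled A : N A = n -> N ((n^-1)%:C *: A) = 1.
  by move=> An; rewrite normZ // An mulVf // gt_eqF.
have := sc ((n^-1)%:C *: rdiag z) ((n^-1)%:C *: rdiag z') t.
rewrite !scaled // (inj_eq (scalerI nC0)) zz => /(_ isT erefl erefl).
rewrite lt_neqAle eq_sym tz t0 lt_neqAle tz1 t1 => /(_ isT isT).
rewrite !scalerA ![(_%:C) * (n^-1)%:C]mulrC -!scalerA -scalerDr -mixE normZ //.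
by rewrite mixN -zN mulVf ?ltxx // gt_eqF.
Qed.

End UnitarilyInvariantNorm.

(** * Optimal completions and the theorem *)

Lemma eq_spec d (U : 'M[C]_d) x y : x =1 y -> spec U x = spec U y.
Proof. by move=> /funext ->. Qed.

Lemma pos_part_negE (u : R) : Num.max u 0 = u + Num.max (- u) 0.
Proof. by rewrite addr_maxr addr0 subrr maxC. Qed.

Section FrameCompletion.
Variables (d k : nat) (U V : 'M[C]_d) (x : 'I_d -> R) (l a w v : nat -> R).
Variable G : 'I_k -> 'cV[C]_d.
Hypotheses (uU : U \is unitarymx) (uV : V \is unitarymx).
Hypothesis lmon : forall i j, (i <= j < d)%N -> l i <= l j.
Hypothesis prof : profile d k l a w v.
Hypothesis Ga : forall i, vnorm (G i) ^+ 2 = a i.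
Hypothesis xE : spec U x = spec V l + frame_op G.

Let sum_a (p : nat) : (p <= k)%N ->
  \sum_(i < k | (i < p)%N) vnorm (G i) ^+ 2 = \sum_(0 <= i < p) a i.
Proof. by move=> pk; rewrite (sum_prefix _ pk); apply: eq_bigr. Qed.

Let sum_a_total : \sum_i vnorm (G i) ^+ 2 = \sum_(0 <= i < k) a i.
Proof. by rewrite big_mkord; apply: eq_bigr. Qed.

Lemma completion_pos_part t :
  \sum_(i < d) Num.max (v i - t) 0 <= \sum_i Num.max (x i - t) 0.
Proof.
rewrite -(big_mkord xpredT (fun i => Num.max (v i - t) 0)).
have [->|[p pn ->]] := profile_pos_part prof t.
  by rewrite -sum_a_total big_mkord; apply: pos_part_ge_trace xE t.
have pd := leq_trans pn (geq_minl d k); have pk := leq_trans pn (geq_minr d k).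
rewrite -(sum_a pk) (sum_prefix _ pd) sum_suffix.
exact: (pos_part_ge_prefix uU uV lmon xE t pd pk).
Qed.

Lemma completion_sum : \sum_i x i = \sum_(i < d) v i.
Proof.
rewrite (sum_spec_add uU uV xE) sum_a_total -(big_mkord xpredT v).
by rewrite (profile_sum prof) !big_mkord.
Qed.

(** Equality in the chain sum v^2 >= sum (l + m)^2 >= sum v^2 + sum (l + m - v)^2,
    with m the spectrum of the frame operator. *)
Lemma completion_rigid :
    \sum_i x i ^+ 2 = \sum_(i < d) v i ^+ 2 ->
  exists Z, [/\ Z \is unitarymx, spec V l = spec Z l &
                frame_op G = spec Z (fun i => v i - l i)].
Proof.
move=> x2; have [W uW BE] := spectral_eigvals (frame_adj G).
set m := nth 0 (eigvals (frame_op G)).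
have mE : spec W (fun i : 'I_d => m i) = frame_op G := esym BE.
have mmon i j : (i <= j < d)%N -> m j <= m i.
  by move=> ij; apply: sorted_nth_anti; rewrite ?size_eigvals // sorted_decr.
have m0 i : (i < d)%N -> 0 <= m i.
  by move=> id_; exact: (frame_eigenvalue_ge0 (Ordinal id_) uW mE).
have mtot : \sum_(0 <= i < d) m i = \sum_(0 <= i < k) a i.
  rewrite big_mkord -sum_a_total; apply: complexI.
  by rewrite -trace_frame -mE (trace_spec (fun i : 'I_d => m i) uW).
have mpre p : (p <= minn d k)%N ->
    \sum_(0 <= i < p) a i <= \sum_(0 <= i < p) m i.
  rewrite leq_min => /andP[pd pk].
  by rewrite -(sum_a pk) (sum_prefix _ pd); apply: (frame_prefix_le uW mE mmon).
pose z i := l i + m i.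
have var : 0 <= \sum_(0 <= i < d) v i * (z i - v i).
  apply: (profile_variational prof) => [i id_|p pn||].
  - by rewrite lerDl m0.
  - by rewrite !big_split /= lerD2l mpre.
  - rewrite [leRHS]big_split /= lerD2l; have [dk|kd] := leqP d k.
      by rewrite mtot.
    by apply: mpre; rewrite leq_min leqnn ltnW.
  - by rewrite big_split /= mtot.
have [lmT lmE] := trace_mul_ge_rearranged uV uW lmon mmon.
set T := complex.Re _ in lmT lmE.
have x2E : \sum_i x i ^+ 2 = \sum_(i < d) l i * l i + \sum_(i < d) m i * m i + 2 * T.
  have := trace_spec_spec x x uU; rewrite xE -mE trace_add_sqr.
  rewrite (trace_spec_spec _ _ uV) (trace_spec_spec _ _ uW).
  move=> /(congr1 (@complex.Re R)); rewrite /T.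
  case: (\tr _) => t1 t2 /= tE; under eq_bigr do rewrite expr2.
  by rewrite -tE; ring.
have zv : \sum_(i < d) (l i * l i + m i * m i + 2 * (l i * m i)) =
    \sum_(i < d) (v i ^+ 2 + 2 * (v i * (z i - v i)) + (z i - v i) ^+ 2).
  by apply: eq_bigr => i _; rewrite /z; ring.
move: zv; rewrite !big_split /= -!mulr_sumr => zv.
rewrite big_mkord in var.
have sq0 : 0 <= \sum_(i < d) (z i - v i) ^+ 2 by apply: sumr_ge0 => i _; rewrite sqr_ge0.
have /psumr_eq0P zv0 : \sum_(i < d) (z i - v i) ^+ 2 = 0 by lra.
have [|Z [uZ SE BZ]] := lmE; first by lra.
exists Z; split; [exact: uZ | exact: SE | rewrite -mE BZ; apply: eq_spec => i].
have /eqP := zv0 (fun i _ => sqr_ge0 _) i isT.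
by rewrite sqrf_eq0 subr_eq0 /z => /eqP zvi; lra.
Qed.

End FrameCompletion.

Lemma orthonormal_eigvec d (U : 'M[C]_d) : U \is unitarymx ->
  orthonormal_basis (eigvec U).
Proof.
move=> uU; split; first by move=> i j; apply: inner_eigvec.
move=> x; exists (fun i => (U *m x) i 0).
rewrite -[LHS]mul1mx -(unitaryKV uU) -mulmxA.
apply/colP => i; rewrite mxE summxE; apply: eq_bigr => j _.
by rewrite mxE mulrC /eigvec !mxE.
Qed.

Lemma sorted_perm_eq d (s t : seq R) (q : {perm 'I_d}) :
    size s = d -> size t = d -> sorted >=%R s -> sorted >=%R t ->
    (forall i : 'I_d, s`_i = t`_(q i)) -> s = t.
Proof.
move=> ss st so to stE; apply: (sorted_eq (leT := >=%R)) => //.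
- by move=> x1 x2 x3 /= h1 h2; apply: le_trans h1.
- by move=> x1 x2 /andP[h1 h2]; apply/le_anti/andP; split.
rewrite -(map_nth_enum ss) -(map_nth_enum st) (eq_map stE).
rewrite (map_comp (fun i : 'I_d => t`_i) q); apply: perm_map.
apply: uniq_perm; rewrite ?enum_uniq ?(map_inj_uniq (@perm_inj _ q)) ?enum_uniq //.
move=> i; rewrite mem_enum inE; apply/mapP; exists (q^-1%g i); rewrite ?mem_enum //.
by rewrite permKV.
Qed.

Lemma decr_perm d (s : seq R) : size s = d ->
  exists p : {perm 'I_d}, forall i : 'I_d, (decr s)`_i = s`_(p i).
Proof.
move=> sz; apply: (@perm_fun d (fun i => (decr s)`_i) (fun i => s`_i)).
by rewrite !map_nth_enum ?size_sort // perm_sort.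
Qed.

End Spectra.

Theorem theorem5p2 (R : realType) (d k : nat) (S0 : 'M[R[i]]_d) (a : k.-tuple R) :
  (0 < d)%N -> (0 < k)%N ->
  psd S0 ->
  (forall i j : 'I_k, (i <= j)%N -> tnth a j <= tnth a i) ->
  (forall i : 'I_k, 0 < tnth a i) ->
  (forall N : 'M[R[i]]_d -> R, is_norm N -> unitarily_invariant N ->
     is_minimum [set N (S0 - frame_op G) | G in torus d a]
                (N (diagonal_mx d (delta S0 a))))
  /\
  (forall N : 'M[R[i]]_d -> R, is_norm N -> unitarily_invariant N ->
     strictly_convex N ->
   forall G : 'I_k -> 'cV[R[i]]_d, torus d a G ->
     (N (S0 - frame_op G) = N (diagonal_mx d (delta S0 a)) <->
      eigvals (S0 - frame_op G) = decr (delta S0 a))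
     /\
     (N (S0 - frame_op G) = N (diagonal_mx d (delta S0 a)) ->
      exists v : 'I_d -> 'cV[R[i]]_d,
        [/\ orthonormal_basis v,
            S0 = \sum_(i < d) ((eigvals S0)`_i)%:C *: tens (v i) (v i)
          & frame_op G =
              \sum_(i < d) ((eigvals S0)`_i - (delta S0 a)`_i)%:C *: tens (v i) (v i)])).
Proof.
move=> d0 k0 [/hermsymmx_adjP S0h _] amon apos.
have [V uV S0E] := spectral_eigvals S0h.
set M := opnorm S0; set lam := lambda_tilde S0.
set e := nth 0 (eigvals S0) in S0E.
have szl : size lam = d by rewrite size_map size_eigvals.
have lamE i : (i < d)%N -> lam`_i = M - e i.
  by move=> id_; rewrite (nth_map 0) ?size_eigvals.
have sl : sorted <=%R lam.
  rewrite sorted_map; apply: sub_sorted (sorted_decr _) => x y /= yx.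
  by rewrite lerB.
have aE (i : 'I_k) : (tval a)`_i = tnth a i by rewrite (tnth_nth 0).
have [|||||sznu [w prof]] := @nuop_profile R lam a.
- by rewrite -size_eq0 szl -lt0n.
- by rewrite -size_eq0 size_tuple -lt0n.
- exact: sl.
- apply/(sortedP 0) => i; rewrite size_tuple => ik.
  by have := amon (Ordinal (ltnW ik)) (Ordinal ik) (leqnSn i); rewrite -!aE.
- by move=> i; rewrite size_tuple => ik; have := apos (Ordinal ik); rewrite -aE.
rewrite szl size_tuple in prof sznu.
set l := nth 0 lam in prof; set v := nth 0 (nuop lam a) in prof.
have lmon i j : (i <= j < d)%N -> l i <= l j.
  move=> /andP[ij jd]; apply: (sorted_leq_nth le_trans lexx 0 sl) => //; rewrite inE szl //.
  exact: leq_ltn_trans ij jd.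
set dl := nth 0 (delta S0 a).
have szd : size (delta S0 a) = d by rewrite size_map.
have dlE i : (i < d)%N -> dl i = M - v i.
  by move=> id_; rewrite /dl (nth_map 0) ?sznu.
have [p pE] := decr_perm szd.
have reidx (f : 'I_d -> R) : \sum_i f (p i) = \sum_i f i.
  by rewrite [RHS](reindex_inj (@perm_inj _ p)).
(* Sorting delta does not change the norm of the diagonal matrix. *)
have NdE N : is_norm N -> unitarily_invariant N ->
    N (rdiag (fun i : 'I_d => (decr (delta S0 a))`_i)) = N (diagonal_mx d (delta S0 a)).
  move=> nN iN; rewrite (funext pE : (fun i : 'I_d => (decr _)`_i) = _).
  exact: (norm_perm iN (fun i : 'I_d => dl i)).
have optimal (G : 'I_k -> 'cV[R[i]]_d) : torus d a G -> [/\
   exists2 U, U \is unitarymx & S0 - frame_op G =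
     spec U (fun i => (eigvals (S0 - frame_op G))`_i),
   forall q, \sum_(i < d | (i < q)%N) (decr (delta S0 a))`_i <=
             \sum_(i < d | (i < q)%N) (eigvals (S0 - frame_op G))`_i,
   \sum_(i < d) (decr (delta S0 a))`_i = \sum_(i < d) (eigvals (S0 - frame_op G))`_i &
   eigvals (S0 - frame_op G) = decr (delta S0 a) ->
   exists Z, [/\ Z \is unitarymx, S0 = spec Z (fun i => e i) &
                 frame_op G = spec Z (fun i => e i - dl i)]].
  move=> tG; set F := frame_op G; set Y := S0 - F.
  have [U uU YE] : exists2 U, U \is unitarymx & Y = spec U (fun i => (eigvals Y)`_i).
    by apply: spectral_eigvals; rewrite /Y adjB S0h frame_adj.
  set y := nth 0 (eigvals Y) in YE *.
  have SlE Z : Z \is unitarymx -> S0 = spec Z (fun i => e i) ->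
      spec Z (fun i => l i) = (M%:C)%:M - S0.
    move=> uZ ->; rewrite -(spec_const M uZ) specB; apply: eq_spec => i.
    exact: lamE.
  (* S0 - F = M - (S + F): the spectrum of S + F is M - y. *)
  have xE : spec U (fun i => M - y i) = spec V (fun i => l i) + F.
    rewrite -(specB U (fun=> M)) (spec_const M uU) -YE (SlE V uV S0E) /Y.
    by rewrite opprB addrA addrAC.
  have Ga i : vnorm (G i) ^+ 2 = (tval a)`_i by rewrite tG aE.
  have ysum : \sum_(i < d) (decr (delta S0 a))`_i = \sum_(i < d) y i.
    rewrite (eq_bigr _ (fun i _ => pE i)) (reidx (fun i => dl i)).
    have := completion_sum uU uV prof Ga xE; rewrite sumrB => sE.
    rewrite (eq_bigr (fun i : 'I_d => M - v i)) => [|i _]; last exact: dlE.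
    by rewrite sumrB -sE; ring.
  split=> //; first by exists U.
  - apply: (@prefix_le_of_pos_part R d (fun i => (decr (delta S0 a))`_i) (fun i => y i)).
      by move=> i j ij; apply: sorted_nth_anti; rewrite ?sorted_decr ?size_eigvals ?ij /=.
    (* u^+ = u + (-u)^+ and equal sums turn the bound for M - y, at threshold
       M - t, into the one for y at threshold t. *)
    move=> t; under eq_bigr do rewrite pos_part_negE.
    under [leRHS]eq_bigr do rewrite pos_part_negE.
    rewrite !big_split /= ysum lerD2l.
    rewrite (eq_bigr (fun i => Num.max (- (dl (p i) - t)) 0)) => [|i _]; last by rewrite pE.
    rewrite (reidx (fun i => Num.max (- (dl i - t)) 0)).
    rewrite (eq_bigr (fun i : 'I_d => Num.max (v i - (M - t)) 0)) => [|i _]; last first.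
      by congr Num.max; rewrite dlE //; ring.
    rewrite [leRHS](eq_bigr (fun i : 'I_d => Num.max (M - y i - (M - t)) 0)) => [|i _];
      last first.
      by congr Num.max; ring.
    exact: (completion_pos_part uU uV lmon prof Ga xE).
  - move=> eqd; have [|Z [uZ lZ FZ]] := completion_rigid uU uV lmon prof Ga xE.
      rewrite (eq_bigr (fun i => (M - dl (p i)) ^+ 2)) => [|i _].
        rewrite (reidx (fun i => (M - dl i) ^+ 2)).
        by apply: eq_bigr => i _; rewrite dlE //; congr (_ ^+ 2); ring.
      by rewrite /y eqd pE.
    exists Z; split; first exact: uZ.
      have -> : S0 = (M%:C)%:M - spec Z (fun i : 'I_d => l i).
        by rewrite -lZ (SlE V uV S0E) opprB addrC subrK.
      rewrite -(spec_const M uZ) specB; apply: eq_spec => i.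
      by rewrite /l lamE // opprB addrC subrK.
    rewrite /F FZ; apply: eq_spec => i; rewrite dlE // /l lamE //; ring.
have szdd : size (decr (delta S0 a)) = d by rewrite size_sort.
have anti (s : seq R) : size s = d -> sorted >=%R s ->
    forall i j : 'I_d, (i <= j)%N -> s`_j <= s`_i.
  by move=> ss so i j ij; apply: sorted_nth_anti; rewrite ?ss ?ij /=.
have compare N (G : 'I_k -> 'cV[R[i]]_d) : is_norm N -> unitarily_invariant N ->
    torus d a G -> N (diagonal_mx d (delta S0 a)) <= N (S0 - frame_op G) /\
    (strictly_convex N -> N (S0 - frame_op G) = N (diagonal_mx d (delta S0 a)) ->
     eigvals (S0 - frame_op G) = decr (delta S0 a)).
  move=> nN iN tG; have [[U uU YE] pre tot _] := optimal G tG.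
  have NY : N (S0 - frame_op G) = N (rdiag (fun i : 'I_d => (eigvals (S0 - frame_op G))`_i)).
    by rewrite {1}YE; apply: norm_spec.
  have [le_ eq_] := norm_rdiag_majorized nN iN (anti _ szdd (sorted_decr _))
    (anti _ (size_eigvals _) (sorted_decr _)) pre tot.
  rewrite NY -(NdE N nN iN); split=> // sc NE.
  have [q qE] := eq_ sc (esym NE).
  by symmetry; apply: (@sorted_perm_eq R d _ _ q) => //; rewrite ?size_eigvals ?sorted_decr.
split=> [N nN iN|N nN iN sc G tG].
  split; last by move=> _ [G tG <-]; have [] := compare N G nN iN tG.
  (* The minimum is attained by a frame whose operator has spectrum v - l in the
     eigenbasis V of S0. *)
  have [|||||||G [GE Ga]] := @frame_exists R d k V (fun i => v i - l i) (tnth a) uV.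
  - by move=> i id_; rewrite subr_ge0 (profile_ge prof).
  - by move=> i ikd; rewrite (profile_tail prof) ?subrr //; lia.
  - by move=> i j ij; apply: (profile_gap_anti prof lmon).
  - exact: amon.
  - by move=> i; rewrite ltW.
  - move=> q qn; have := profile_prefix prof qn; rewrite big_split /= sumrB lerBrDl.
    rewrite (sum_prefix (nth 0 a) (leq_trans qn (geq_minr _ _))).
    by under [X in _ + X <= _]eq_bigr do rewrite aE.
  - have := profile_sum prof; rewrite sumrB !big_mkord => ->.
    by rewrite addrAC subrr add0r; apply: eq_bigr => i _; rewrite -aE.
  exists G; first by move=> i; rewrite Ga.
  have -> : S0 - frame_op G = spec V (fun i : 'I_d => dl i).
    rewrite {1}S0E GE specB; apply: eq_spec => i.
    by rewrite dlE // /l lamE //; ring.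
  exact: norm_spec.
have [le_ eq_] := compare N G nN iN tG.
have [[U uU YE] pre tot rigid] := optimal G tG.
split; first split.
- exact: eq_.
- by move=> E; rewrite YE (norm_spec iN _ uU) E; apply: NdE.
move=> /(eq_ sc) /rigid [Z [uZ S0Z FZ]]; exists (eigvec Z); split.
- exact: orthonormal_eigvec.
- by rewrite {1}S0Z spec_sum_tens.
- by rewrite FZ spec_sum_tens.
Qed.
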